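(* Let $G$ be a totally disconnected locally compact group acting vertex transitively, with compact open vertex stabilisers, on a locally finite connected $\delta$-hyperbolic graph $\Gamma$. Then: (i) The map which sends a hyperbolic element $g\in G$ moving towards infinity to its attracting point $\omega_+(g)\in\partial\Gamma$ induces an injection from the set of directions $\partial G$ to $\partial\Gamma$; that is, $\partial(g)\mapsto\omega_+(g)$ is a well-defined injective map $\partial G\to\partial\Gamma$. (ii) Distinct asymptotic classes have distance $2$ apart in the space of directions metric; that is, if $g,h\in G$ move towards infinity and $g\not\asymp h$, then $\delta(g,h)=2$.
   Context: Topological groups are Hausdorff; $\mathbb N=\{1,2,\dots\}$, $\mathbb N_0=\{0\}\cup\mathbb N$. Graphs. A graph has a countable vertex set and a symmetric, diagonal-free edge set; edges are identified with unit intervals, giving the path metric. Locally finite means each vertex is adjacent to finitely many vertices. A geodesic metric space $X$ is $\delta$-hyperbolic if each side of every geodesic triangle lies in the $\delta$-neighbourhood of the union of the other two sides; $\delta$ is also taken large enough that $(x\mid y)_p\ge\min\{(x\mid z)_p,(y\mid z)_p\}-\delta$ for all $x,y,z,p\in X$, where $(x\mid y)_p=\frac12(d(x,p)+d(y,p)-d(x,y))$. The hyperbolic boundary $\partial X$ is the set of infinite geodesic rays modulo finite Hausdorff distance (equivalently, sequences converging at infinity modulo equivalence). An isometry $g$ of $X$ is elliptic if it has a bounded orbit; parabolic if it is not elliptic and fixes a unique point of $\partial X$; hyperbolic if it is not elliptic and fixes precisely two distinct points of $\partial X$. If $g$ is hyperbolic, the two fixed points are $\omega_+(g)=\lim_{n\to\infty}g^n(x)$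 (the attracting point) and $\omega_-(g)=\lim_{n\to\infty}g^{-n}(x)$, for any $x\in X$. An element of $G$ is called elliptic/parabolic/hyperbolic according to its action on $\Gamma$. It is known that for $G$ as in the statement every element with scale $>1$ is hyperbolic. Scale and directions. $\mathrm{COS}(G)$ is the set of compact open subgroups of $G$, with metric $d(U,V)=\log([U:U\cap V][V:U\cap V])$. For $\alpha\in\mathrm{Aut}(G)$ (bicontinuous automorphisms), the scale is $s(\alpha)=\min\{[\alpha(U):\alpha(U)\cap U]\mid U\in\mathrm{COS}(G)\}$; for $g\in G$, $s(g)$ is the scale of the inner automorphism $x\mapsto gxg^{-1}$. $\alpha$ moves towards infinity if $s(\alpha)>1$. Two automorphisms are asymptotic, $\alpha\asymp\beta$, if there exist $k_\alpha,k_\beta\in\mathbb N$ and $U_\alpha,U_\beta\in\mathrm{COS}(G)$ such that $d(\alpha^{nk_\alpha}(U_\alpha),\beta^{nk_\beta}(U_\beta))$ is bounded over $n\in\mathbb N_0$; this is an equivalence relation. Elements of $G$ are identified with the corresponding inner automorphisms; for $g\in G$ moving towards infinity, $\partial(g)$ denotes its asymptotic class in $G$, and $\partial G=\{\partial(g)\mid g\in G,\ s(g)>1\}$ is the set of directions of $G$. For $\alpha,\beta$ moving towards infinity and $U,V\in\mathrm{COS}(G)$ set $$\delta_{+,n}^{U,V}(\alpha,\beta)=\min\left\{\frac{\log[\alpha^n(U):\alpha^n(U)\cap\beta^k(V)]}{n\log s(\alpha)}\ \Big|\ k\in\mathbb N_0,\ s(\beta^k)\le s(\alpha^n)\right\},$$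 $\delta_+(\alpha,\beta)=\limsup_{n\to\infty}\delta_{+,n}^{U,V}(\alpha,\beta)$ (known to be independent of $U,V$), and $\delta(\alpha,\beta)=\delta_+(\alpha,\beta)+\delta_+(\beta,\alpha)$. It is known that $\delta(\cdot,\cdot)$ is a pseudometric vanishing on asymptotic pairs, so it induces a pseudometric on $\partial G$; the space of directions is the completion of the associated metric quotient. (The two-argument function $\delta(\cdot,\cdot)$ is unrelated to the hyperbolicity constant $\delta$.) *)

(* Defs.v *)
From HB Require Import structures.
From mathcomp Require Import all_boot all_order all_algebra.
From mathcomp Require Import finmap.
From mathcomp Require Import all_classical all_reals all_analysis.

Set Implicit Arguments.
Unset Strict Implicit.
Unset Printing Implicit Defensive.

Import Order.TTheory GRing.Theory Num.Theory.
Import numFieldNormedType.Exports.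

Local Open Scope classical_set_scope.
Local Open Scope ring_scope.

(* A graph: [adj u v] says that {u, v} is an edge. *)
Record graph := Graph {
  vertex :> countType;
  adj : rel vertex;
  adj_sym : symmetric adj;
  adj_irr : irreflexive adj
}.

(* Connected graphs are nonempty. *)
Record connected_graph := ConnectedGraph {
  cgraph :> graph;
  cgraph_nonempty : exists v : cgraph, True;
  cgraph_connected : forall u v : cgraph,
    exists2 p : seq cgraph, path (@adj cgraph) u p & last u p = v
}.

Definition locally_finite (Gamma : graph) :=
  forall v : Gamma, finite_set [set w | adj v w].

(* The geometric realization, in barycentric coordinates: the point at
   distance t from u on the edge {u, v} is the function V -> R with value
   1 - t at u, value t at v, and value 0 at the other vertices; the vertex u
   itself is the indicator function of u. *)
Section Realization.
Variables (R : realType) (Gamma : graph).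

Definition edge_point (u v : Gamma) (t : R) : Gamma -> R :=
  fun w => (1 - t) * (w == u)%:R + t * (w == v)%:R.

Definition on_edge (u v : Gamma) (x : Gamma -> R) :=
  exists2 t : R, 0 <= t <= 1 & x = edge_point u v t.

Definition is_point (x : Gamma -> R) :=
  exists u v : Gamma, (adj u v \/ u = v) /\ on_edge u v x.

(* [polyline x y l]: some finite chain of points from x to y, in which any two
   consecutive points lie on a common edge, has total length l. *)
Inductive polyline : (Gamma -> R) -> (Gamma -> R) -> R -> Prop :=
| polyline_nil x : polyline x x 0
| polyline_cons u v x y z l : adj u v -> on_edge u v x -> on_edge u v y ->
    polyline y z l -> polyline x z (`|x u - y u| + l).

Definition path_dist (x y : Gamma -> R) : R := inf [set l | polyline x y l].

Lemma edge_pointl u v t : adj u v -> edge_point u v t u = 1 - t.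
Proof.
move=> uv; rewrite /edge_point eqxx mulr1.
have /negPf -> : u != v by apply: contraTneq uv => ->; rewrite adj_irr.
by rewrite mulr0 addr0.
Qed.

Lemma edge_pointC u v t : edge_point u v t = edge_point v u (1 - t).
Proof. by apply/funext => w; rewrite /edge_point subKr addrC. Qed.

Lemma on_edgeC u v x : on_edge u v x -> on_edge v u x.
Proof.
move=> [t /andP[t0 t1] ->]; exists (1 - t); last exact: edge_pointC.
by rewrite subr_ge0 t1 lerBlDr lerDl.
Qed.

Lemma edge_lipschitz u v x y w : adj u v -> on_edge u v x -> on_edge u v y ->
  `|x w - y w| <= `|x u - y u|.
Proof.
move=> uv [s _ ->] [t _ ->]; rewrite !edge_pointl// /edge_point.
have [->|wu] := eqVneq w u.
  have /negPf -> : u != v by apply: contraTneq uv => ->; rewrite adj_irr.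
  by rewrite !mulr1 !mulr0 !addr0.
rewrite !mulr0 !add0r; case: eqVneq => _; rewrite ?mulr1 ?mulr0 ?subrr ?normr0//.
have -> : 1 - s - (1 - t) = t - s by rewrite opprB [LHS]addrC addrA subrK.
by rewrite distrC.
Qed.

Lemma polyline_lipschitz x y l w : polyline x y l -> `|x w - y w| <= l.
Proof.
elim=> [z|u v a b c k uv xe ye _ ih]; first by rewrite subrr normr0.
rewrite (le_trans (ler_distD (b w) _ _))// lerD//; exact: (edge_lipschitz _ uv).
Qed.

Lemma polyline_ge0 x y l : polyline x y l -> 0 <= l.
Proof. by elim=> // *; rewrite addr_ge0. Qed.

Lemma polyline_cat x y z k l :
  polyline x y k -> polyline y z l -> polyline x z (k + l).
Proof.
move=> xy yz; elim: xy yz => {x y k} [x|u v x y w k uv xe ye _ ih] yz.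
  by rewrite add0r.
by rewrite -addrA; apply: (polyline_cons uv xe ye); exact: ih.
Qed.

Lemma polyline_sym x y l : polyline x y l -> polyline y x l.
Proof.
elim=> {x y l} [x|u v x y z l uv xe ye _ ih]; first exact: polyline_nil.
rewrite addrC; apply: (polyline_cat ih); rewrite distrC -(addr0 (`| _ |)).
exact: (polyline_cons uv ye xe (polyline_nil _)).
Qed.

Lemma path_dist_lbound x y : lbound [set l | polyline x y l] 0.
Proof. by move=> l; exact: polyline_ge0. Qed.

Lemma path_dist_le x y l : polyline x y l -> path_dist x y <= l.
Proof. by move=> xy; apply: ge_inf => //; exists 0; exact: path_dist_lbound. Qed.

Lemma path_dist_sym x y : path_dist x y = path_dist y x.
Proof.
by rewrite /path_dist; congr inf; apply/seteqP; split => l /polyline_sym.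
Qed.

Lemma path_distxx x : path_dist x x = 0.
Proof.
apply/eqP; rewrite eq_le path_dist_le/=; last exact: polyline_nil.
apply: lb_le_inf; last exact: path_dist_lbound.
by exists 0; exact: polyline_nil.
Qed.

End Realization.

Section RealizationMetric.
Variables (R : realType) (Gamma : connected_graph).

Definition realization : Type := {x : Gamma -> R | is_point x}.

HB.instance Definition _ := gen_eqMixin realization.
HB.instance Definition _ := gen_choiceMixin realization.

Let dist (x y : realization) : R := path_dist (sval x) (sval y).

Lemma polyline_vertices (u v : Gamma) (p : seq Gamma) :
  path (@adj Gamma) u p -> last u p = v ->
  exists l : R, polyline (edge_point u u 0) (edge_point v v 0) l.
Proof.
elim: p u => [u _ <-|a p ih u /= /andP[ua ap] pv].
  by exists 0; exact: polyline_nil.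
have [l al] := ih _ ap pv.
have e0 (b c : Gamma) : edge_point b b 0 = edge_point b c 0 :> (Gamma -> R).
  by apply/funext => w; rewrite /edge_point !mul0r.
exists (`|edge_point u u 0 u - edge_point a a 0 u| + l).
apply: (polyline_cons ua) al; first by exists 0; rewrite ?lexx ?ler01.
by apply: on_edgeC; exists 0; rewrite ?lexx ?ler01.
Qed.

Lemma polyline_to_vertex (x : realization) :
  exists (u : Gamma) (l : R), polyline (sval x) (edge_point u u 0) l.
Proof.
case: x => x /= [u [v [uv xe]]]; exists u.
have e0 (c : Gamma) : edge_point u u 0 = edge_point u c 0 :> (Gamma -> R).
  by apply/funext => w; rewrite /edge_point !mul0r.
case: uv => [uv|uv].
  exists (`|x u - edge_point u u 0 u| + 0).
  apply: (polyline_cons uv xe); last exact: polyline_nil.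
  by exists 0; rewrite ?lexx ?ler01.
exists 0; suff -> : x = edge_point u u 0 by exact: polyline_nil.
move: xe; rewrite -uv => -[t _ ->]; apply/funext => w.
by rewrite /edge_point -!mulrDl !subrK.
Qed.

Lemma polyline_exists (x y : realization) :
  exists l : R, polyline (sval x) (sval y) l.
Proof.
have [u [k xu]] := polyline_to_vertex x.
have [v [l yv]] := polyline_to_vertex y.
have [p up pv] := cgraph_connected u v.
have [m uv] := polyline_vertices up pv.
exists (k + (m + l)); apply: polyline_cat xu _; apply: polyline_cat uv _.
exact: polyline_sym.
Qed.

Let distxx x : dist x x = 0.
Proof. exact: path_distxx. Qed.

Let dist_positivity x y : dist x y = 0 -> x = y.
Proof.
have ne := polyline_exists x y; case: x y ne => [x px] [y py] /= ne xy0.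
apply/eq_exist/funext => w; apply/eqP; rewrite -subr_eq0 -normr_le0 -xy0.
by apply: lb_le_inf => // l /polyline_lipschitz.
Qed.

Let dist_sym x y : dist x y = dist y x.
Proof. exact: path_dist_sym. Qed.

Let dist_triangle y x z : dist x z <= dist x y + dist y z.
Proof.
rewrite -lerBlDr; apply: lb_le_inf; first exact: polyline_exists.
move=> k /= xy; rewrite lerBlDl -lerBlDr.
apply: lb_le_inf; first exact: polyline_exists.
move=> l /= yz; rewrite lerBlDl; apply: path_dist_le.
exact: polyline_cat xy yz.
Qed.

HB.instance Definition _ := @isMetric.Build R realization dist distxx
  dist_positivity dist_sym dist_triangle.

End RealizationMetric.

Section MetricSpace.
Variables (R : realType) (X : metricType R).
Implicit Types (x y z p : X) (f : X -> X) (S : set X).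

Definition geodesic_segment x y S := exists (l : R) (c : R -> X),
  [/\ 0 <= l, c 0 = x /\ c l = y,
      {in `[0, l] &, forall s t, mdist (c s) (c t) = `|s - t|} &
      S = c @` [set` `[0, l]]].

Definition gromov_product p x y : R :=
  (mdist x p + mdist y p - mdist x y) / 2.

(* By cyclic symmetry the first conjunct concerns each side of the triangle.
   The second conjunct is the convention that the constant is large enough
   for the four-point inequality. *)
Definition gromov_hyperbolic (delta : R) :=
  (forall x y z S1 S2 S3, geodesic_segment x y S1 -> geodesic_segment y z S2 ->
     geodesic_segment z x S3 ->
     forall p, S1 p -> exists2 q, (S2 `|` S3) q & mdist p q <= delta) /\
  (forall x y z p, gromov_product p x y >=
     Num.min (gromov_product p x z) (gromov_product p y z) - delta).

(* Only the values of a ray on [0, +oo[ matter. *)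
Definition geodesic_ray (r : R -> X) :=
  forall s t, 0 <= s -> 0 <= t -> mdist (r s) (r t) = `|s - t|.

Definition finite_hausdorff (A B : set X) := exists K : R,
  (forall a, A a -> exists2 b, B b & mdist a b <= K) /\
  (forall b, B b -> exists2 a, A a & mdist a b <= K).

Definition ray_class (r : R -> X) : set (R -> X) :=
  [set r' | geodesic_ray r' /\
    finite_hausdorff (r @` [set` `[0, +oo[]) (r' @` [set` `[0, +oo[])].

(* A point of the hyperbolic boundary is an equivalence class of rays. *)
Definition boundary : set (set (R -> X)) :=
  [set ray_class r | r in geodesic_ray].

Definition boundary_map f (omega : set (R -> X)) : set (R -> X) :=
  [set f \o r | r in omega].

Definition converges_at_infinity (u : nat -> X) := forall p (M : R),
  exists N, forall i j, (N <= i)%N -> (N <= j)%N ->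
    M <= gromov_product p (u i) (u j).

Definition equivalent_at_infinity (u v : nat -> X) := forall p (M : R),
  exists N, forall i j, (N <= i)%N -> (N <= j)%N ->
    M <= gromov_product p (u i) (v j).

(* The boundary point omega corresponds to the class of the sequences
   (r n)_n with r in omega. *)
Definition converges_to_boundary (u : nat -> X) (omega : set (R -> X)) :=
  [/\ boundary omega, converges_at_infinity u &
      forall r, omega r -> equivalent_at_infinity u (fun n => r n%:R)].

(* The next notions are meant for surjective isometries f. As
   d(x, f^-n x) = d(x, f^n x), it is enough to bound the forward orbit. *)
Definition elliptic f :=
  exists x (K : R), forall n, mdist x (iter n f x) <= K.

Definition hyperbolic_isometry f := ~ elliptic f /\
  exists omega1 omega2, omega1 <> omega2 /\
    [set omega | boundary omega /\ boundary_map f omega = omega]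
      = [set omega1; omega2].

Definition attracting_point f (omega : set (R -> X)) :=
  hyperbolic_isometry f /\
  forall x, converges_to_boundary (fun n => iter n f x) omega.

End MetricSpace.
Arguments boundary {R} X _.

HB.structure Definition PreTopologicalGroup :=
  {G of Topological G & Group G}.

HB.mixin Record PreTopologicalGroup_isTopologicalGroup G
    & PreTopologicalGroup G := {
  mulg_continuous : continuous (fun z : G * G => (z.1 * z.2)%g);
  invg_continuous : continuous (fun x : G => (x^-1)%g)
}.

#[short(type="topologicalGroupType")]
HB.structure Definition TopologicalGroup :=
  {G of PreTopologicalGroup G & PreTopologicalGroup_isTopologicalGroup G}.

(* The least element of A if there is one, and x0 otherwise. *)
Definition least d (T : porderType d) (x0 : T) (A : set T) : T :=
  xget x0 (A `&` lbound A).

(* The functions alpha, beta : G -> G below are meant to be bicontinuous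
   automorphisms. Powers are iterates. *)
Section Scale.
Variables (R : realType) (G : topologicalGroupType).
Implicit Types (U V : set G) (alpha beta : G -> G).

Definition subgroup U := U 1%g /\ forall x y, U x -> U y -> U (x * y^-1)%g.

Definition COS : set (set G) := [set U | [/\ subgroup U, compact U & open U]].

(* The index [U : U `&` V]: the number of left cosets. *)
Definition index_cap U V : nat :=
  #|` fset_set [set [set (x * w)%g | w in U `&` V] | x in U] |.

Definition COS_dist U V : R := ln (index_cap U V * index_cap V U)%:R.

Definition scale alpha : nat :=
  least 0%N [set index_cap (alpha @` U) U | U in COS].

Definition moves_to_infinity alpha := (1 < scale alpha)%N.

Definition asymptotic alpha beta :=
  exists (ka kb : nat) U V,
    [/\ (0 < ka)%N, (0 < kb)%N, COS U, COS V &
      exists C : R, forall n : nat,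
        COS_dist (iter (n * ka) alpha @` U) (iter (n * kb) beta @` V) <= C].

Definition delta_plus_seq U V alpha beta (n : nat) : R :=
  least 0 [set ln (index_cap (iter n alpha @` U) (iter k beta @` V))%:R
               / (n%:R * ln (scale alpha)%:R)
          | k in [set k | (scale (iter k beta) <= scale (iter n alpha))%N]].

(* [delta_plus alpha beta r]: the limit superior has the value r for every
   choice of U and V. *)
Definition delta_plus alpha beta (r : \bar R) := forall U V, COS U -> COS V ->
  limn_esup (fun n => (delta_plus_seq U V alpha beta n)%:E) = r.

Definition delta_dist alpha beta (r : \bar R) := exists r1 r2,
  [/\ delta_plus alpha beta r1, delta_plus beta alpha r2 & r = (r1 + r2)%E].

Definition inner (g : G) : G -> G := fun x => (g * x * g^-1)%g.

Definition direction (g : G) : set G :=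
  [set h | asymptotic (inner g) (inner h)].

Definition directions : set (set G) :=
  [set direction g | g in [set g | moves_to_infinity (inner g)]].

End Scale.
Arguments directions : clear implicits.

Record graph_action (G : groupType) (Gamma : graph) := GraphAction {
  gact :> G -> Gamma -> Gamma;
  gact1 : forall v, gact 1%g v = v;
  gactM : forall g h v, gact (g * h)%g v = gact g (gact h v);
  gact_adj : forall g u v, adj (gact g u) (gact g v) = adj u v
}.

Definition vertex_transitive (G : groupType) (Gamma : graph)
    (a : graph_action G Gamma) :=
  forall u v, exists g, a g u = v.

Definition stabiliser (G : groupType) (Gamma : graph)
  (a : graph_action G Gamma) (v : Gamma) : set G := [set g | a g v = v].

Section InducedAction.
Variables (R : realType) (G : groupType) (Gamma : connected_graph).
Variable a : graph_action G Gamma.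

Lemma gact_is_point (g : G) (x : Gamma -> R) :
  is_point x -> is_point (x \o a g^-1%g).
Proof.
move=> [u [v [uv [t t01 ->]]]]; exists (a g u), (a g v).
split; first by case: uv => [uv|->]; [left; rewrite gact_adj | right].
exists t => //; apply/funext => w /=.
suff e z : (a g^-1%g w == z) = (w == a g z) by rewrite /edge_point !e.
by apply/eqP/eqP => [<-|->]; rewrite -gactM ?mulgV ?mulVg gact1.
Qed.

(* Moving a weight from each vertex v to g v changes the barycentric
   coordinates x into w |-> x (g^-1 w). *)
Definition point_action (g : G) (x : realization R Gamma) :
    realization R Gamma :=
  exist _ (sval x \o a g^-1%g) (gact_is_point g (svalP x)).

End InducedAction.

(* Main.v *)
From HB Require Import structures.
Require Import Defs.
From mathcomp Require Import all_boot all_order all_algebra.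
From mathcomp Require Import finmap.
From mathcomp Require Import all_classical all_reals all_analysis.
From mathcomp Require Import zify ring lra.

Set Implicit Arguments.
Unset Strict Implicit.
Unset Printing Implicit Defensive.

Import Order.TTheory GRing.Theory Num.Theory.
Import numFieldNormedType.Exports.

Local Open Scope classical_set_scope.

(** The orbit of a vertex [v] carries both the geometry and the indices: the
stabiliser [G_p] of a vertex [p] is compact and open, [g G_p g^-1 = G_(g p)],
and |G_p : G_p ∩ G_q| is the size of the orbit of [q] under [G_p], which is
at most exponential in the distance from [p] to [q]. Write [x_n = g^n v].

The group-theoretic input is that |G_(x_n) : G_(x_n) ∩ G_v| is [s(g)^n] up to
a bounded factor. The upper bound is submultiplicativity of indices. The lower
bound is the tidying procedure of Willis in a shortened form
([scale_growth]): for suitable compact open [V] inside [G_v], with [V+] the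
intersection of the [g^i V g^-i] for [i >= 0], one has s(g)^n <= |g^n V+ g^-n : V|, the index
counting cosets of [V]. The elements of [V+] fix all the [x_i].

If [s(g) > 1], comparison of the exponential lower bound with the exponential
upper bound in the distance shows that [d(v, x_n)] grows linearly. In a space
satisfying the four-point inequality this forces
[d(v, x_m) + d(v, x_n) <= d(v, x_(m+n)) + K] ([orbit_quasigeodesic]), so that
the Gromov products along the orbit are controlled: the orbits of [g] and of
its inverse converge to distinct boundary points, represented by rays thanks to
König's lemma ([ray_to_limit]), and a fixed boundary point different from both
would be moved ([fixed_ray]). So [g] is hyperbolic, and its attracting point is
the limit of [x_n] ([orb_attracting]).

Let [h] be another element with [s(h) > 1], and [y_k = h^k v].

If the limits differ, the products [(x_n | y_k)_v] are bounded. An element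
fixing [x_n] and [y_k] then moves [v] a bounded distance, and therefore
|G_(x_n) : G_(x_n) ∩ G_(y_k)| >= c s(g)^n for all [k] ([distinct_ends]). In
particular [g] and [h] are not asymptotic; and since [k = 0] is an admissible
choice, with index of order [s(g)^n], the limit superior defining the
one-sided distance is 1, on both sides, which gives the distance 2
([delta_plus1]).

If the limits agree, let [P] be the stabiliser of the common limit and [P_q] the
stabiliser of the vertex [q] in [P]. The ratio of |P_p : P_p ∩ P_q| and
|P_q : P_p ∩ P_q| is a [P]-invariant cocycle, so [u] maps to the ratio of
[P_(u v)] and [P_v] by a homomorphism ([modulusM]), a modular function of [P].
It exceeds 1 at [h], because [V+] lies in [P] while elements of [P_v] move the
[y_n] a bounded distance ([modulus_h_gt1]). The orbits run within a bounded
distance of each other, so the vertices [g^-n h^(m n) v] lie in a finite ball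
for some [m n]; two equal ones give positive [k], [l] with equal moduli of [g^k]
and [h^l]. Hence the modulus of [h^(m (j k) - j l)] is bounded for all [j], so
that [m (j k) - j l] is bounded, [g^(j k) v] stays near [h^(j l) v], and [g], [h]
are asymptotic ([same_end_close]).

Thus two elements moving towards infinity are asymptotic exactly when their
attracting points agree. *)

(** * Indices of subgroups *)

Section Index.
Local Open Scope group_scope.
Variable G : topologicalGroupType.
Implicit Types (A B C : set G) (s t : seq G).

Lemma subgroup1 A : subgroup A -> A 1.
Proof. by case. Qed.

Lemma subgroupV A x : subgroup A -> A x -> A x^-1.
Proof. by move=> [A1 AM] Ax; rewrite -[x^-1]mul1g; exact: AM. Qed.

Lemma subgroupM A x y : subgroup A -> A x -> A y -> A (x * y).
Proof. by move=> sA Ax Ay; rewrite -[y]invgK; apply: sA.2 => //;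
  exact: subgroupV. Qed.

Lemma subgroupMl A x y : subgroup A -> A x -> A (x * y) -> A y.
Proof. by move=> sA Ax Axy; rewrite -(mulKg x y); apply: subgroupM => //;
  exact: subgroupV. Qed.

Lemma subgroupMr A x y : subgroup A -> A y -> A (x * y) -> A x.
Proof. by move=> sA Ay Axy; rewrite -(mulgK y x); apply: sA.2. Qed.

Lemma subgroupI A B : subgroup A -> subgroup B -> subgroup (A `&` B).
Proof.
move=> [A1 AM] [B1 BM]; split; first by split.
by move=> x y [Ax Bx] [Ay By]; split; [exact: AM | exact: BM].
Qed.

Definition lcos B x : set G := [set x * w | w in B].

Definition cosets A B : set (set G) := [set lcos B x | x in A].

Definition fin_idx A B := finite_set (cosets A B).

(** For subgroups this is the index of [A ∩ B] in [A] ([idxIr]). Allowing a set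
[A] makes it possible to bound an index by the cosets met by a larger set of
elements, such as those moving a vertex a bounded distance. *)
Definition idx A B : nat := #|` fset_set (cosets A B)|.

Lemma lcosP B x y : subgroup B -> lcos B x = lcos B y <-> B (x^-1 * y).
Proof.
move=> sB; split=> [e|Bxy].
  have : lcos B y y by exists 1; [exact: subgroup1 | rewrite mulg1].
  by rewrite -e => -[w Bw <-]; rewrite mulKg.
apply/seteqP; split=> _ [w Bw <-].
  exists (y^-1 * x * w); last by rewrite !mulgA mulgV mul1g.
  by apply: subgroupM => //; rewrite -[_ * x]invgK invgM invgK;
    exact: subgroupV.
by exists (x^-1 * y * w); [exact: subgroupM | rewrite !mulgA mulgV mul1g].
Qed.

Definition coset_reps s A B :=
  [/\ uniq s, {in s, forall x, A x},
      forall a, A a -> exists2 x, x \in s & B (x^-1 * a) &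
      {in s &, forall x y, B (x^-1 * y) -> x = y}].

Lemma coset_reps_cosets s A B : subgroup B -> coset_reps s A B ->
  cosets A B = [set` [fset y | y in map (lcos B) s]%fset].
Proof.
move=> sB [us sA As sI]; apply/seteqP; split=> X /=.
  move=> [a Aa <-]; have [x xs Bxa] := As _ Aa.
  rewrite inE; apply/mapP; exists x => //.
  by apply/esym/lcosP.
by rewrite inE => /mapP[x xs ->]; exists x => //; exact: sA.
Qed.

Lemma coset_reps_fin s A B : subgroup B -> coset_reps s A B -> fin_idx A B.
Proof. by move=> sB /(coset_reps_cosets sB) e; rewrite /fin_idx e;
  exact: finite_fset. Qed.

Lemma coset_reps_idx s A B : subgroup B -> coset_reps s A B -> idx A B = size s.
Proof.
move=> sB ts; rewrite /idx (coset_reps_cosets sB ts) set_fsetK.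
have [us sA As sI] := ts.
rewrite card_fseq undup_id ?size_map// map_inj_in_uniq// => x y xs ys.
by move/(lcosP _ _ sB); exact: sI.
Qed.

Lemma coset_reps_ex A B : subgroup B -> fin_idx A B -> exists s, coset_reps s A B.
Proof.
move=> sB /finite_seqP[t et].
pose rep X := xget 1 [set x | A x /\ lcos B x = X].
have repP X : X \in t -> A (rep X) /\ lcos B (rep X) = X.
  move=> Xt; have : cosets A B X by rewrite et.
  by move=> [x Ax xX]; rewrite /rep; case: xgetP => [y _ //|/(_ x)]; case.
exists (map rep (undup t)); split.
- rewrite map_inj_in_uniq ?undup_uniq// => X Y; rewrite !mem_undup => Xt Yt e.
  by have [_ <-] := repP _ Xt; rewrite e; have [] := repP _ Yt.
- by move=> x /mapP[X]; rewrite mem_undup => /repP[? _] ->.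
- move=> a Aa; have at_ : lcos B a \in t.
    by have : cosets A B (lcos B a) by [exists a]; rewrite et.
  exists (rep (lcos B a)); first by apply: map_f; rewrite mem_undup.
  by apply/lcosP => //; have [] := repP _ at_.
- move=> x y /mapP[X]; rewrite mem_undup => /repP[_ eX] ->.
  move=> /mapP[Y]; rewrite mem_undup => /repP[_ eY] ->.
  by move/(lcosP _ _ sB); rewrite eX eY => ->.
Qed.

(** A representative modulo [B] settles the class modulo [B]; it is then
corrected modulo [C] by an element of [A ∩ B], which does not affect that
class. *)
Lemma coset_reps_mul s t A B C : subgroup A -> subgroup B ->
  coset_reps s A B -> coset_reps t (A `&` B) C ->
  coset_reps [seq x * y | x <- s, y <- t] A (B `&` C).
Proof.
move=> gA gB [us sA As sI] [ut tAB At tI]; split.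
- apply: allpairs_uniq => // p q /allpairsP[[x y] /= [xs yt ->]].
  move=> /allpairsP[[x' y'] /= [xs' yt' ->]] /= e.
  suff xx : x = x' by move: e; rewrite xx => /mulgI ->.
  apply: sI => //; have [_ By] := tAB _ yt; have [_ By'] := tAB _ yt'.
  have -> : x^-1 * x' = y * y'^-1.
    by rewrite -[x in LHS](mulgK y) e !invgM invgK !mulgA mulgVK.
  by apply: gB.2.
- move=> p /allpairsP[[x y] /= [xs /tAB[Ay _] ->]].
  by apply: subgroupM => //; exact: sA.
- move=> a Aa; have [x xs Bxa] := As _ Aa.
  have [|y yt Cy] := At (x^-1 * a).
    by split => //; apply: subgroupM => //; apply: subgroupV => //; exact: sA.
  exists (x * y); first exact: allpairs_f.
  rewrite invgM -mulgA; split => //; apply: subgroupM => //.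
  by apply: subgroupV => //; exact: (tAB _ yt).2.
- move=> p q /allpairsP[[x y] /= [xs yt ->]] /allpairsP[[x' y'] /= [xs' yt' ->]].
  rewrite invgM => -[Bxy Cxy].
  have [_ By] := tAB _ yt; have [_ By'] := tAB _ yt'.
  have xx : x = x'.
    apply: sI => //; apply: (subgroupMr gB By').
    by apply: (subgroupMl gB (subgroupV gB By)); rewrite !mulgA in Bxy *.
  rewrite -xx in Cxy *; congr (_ * _); apply: tI => //.
  by rewrite -mulgA mulKg in Cxy.
Qed.

Lemma fin_idxI A B C : subgroup A -> subgroup B -> subgroup C ->
  fin_idx A B -> fin_idx (A `&` B) C -> fin_idx A (B `&` C).
Proof.
move=> gA gB gC /(coset_reps_ex gB)[s ts] /(coset_reps_ex gC)[t tt].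
exact: (coset_reps_fin (subgroupI gB gC) (coset_reps_mul gA gB ts tt)).
Qed.

Lemma idxI A B C : subgroup A -> subgroup B -> subgroup C ->
  fin_idx A B -> fin_idx (A `&` B) C ->
  idx A (B `&` C) = (idx A B * idx (A `&` B) C)%N.
Proof.
move=> gA gB gC /(coset_reps_ex gB)[s ts] /(coset_reps_ex gC)[t tt].
rewrite (coset_reps_idx (subgroupI gB gC) (coset_reps_mul gA gB ts tt)).
by rewrite (coset_reps_idx gB ts) (coset_reps_idx gC tt) size_allpairs.
Qed.

Lemma fin_idx_subset_l A A' B : A `<=` A' -> fin_idx A' B -> fin_idx A B.
Proof. by move=> AA; apply: sub_finite_set; apply: image_subset. Qed.

Lemma leq_card_set (T : choiceType) (X Y : set T) : finite_set Y -> X `<=` Y ->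
  (#|` fset_set X| <= #|` fset_set Y|)%N.
Proof.
move=> fY XY; have fX := sub_finite_set XY fY.
by apply: fsubset_leq_card; rewrite -fset_set_sub.
Qed.

Lemma idx_subset_l A A' B : A `<=` A' -> fin_idx A' B -> (idx A B <= idx A' B)%N.
Proof. by move=> AA fA; apply: leq_card_set => //; exact: image_subset. Qed.

Lemma cosets_subl A A' B : subgroup B ->
  (forall a, A a -> exists2 b, A' b & B (b^-1 * a)) -> cosets A B `<=` cosets A' B.
Proof.
move=> gB AA _ [a Aa <-]; have [b Ab Bba] := AA _ Aa.
by exists b => //; apply/lcosP.
Qed.

(** The variant of monotonicity in which [A] need not lie in [A'], only in
[A' B]. *)
Lemma idx_cosubl A A' B : subgroup B ->
  (forall a, A a -> exists2 b, A' b & B (b^-1 * a)) -> fin_idx A' B ->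
  (idx A B <= idx A' B)%N.
Proof. by move=> gB AA fA; apply: leq_card_set => //; exact: cosets_subl. Qed.

Lemma coset_reps_self A B : subgroup B -> A `<=` B -> A 1 -> coset_reps [:: 1] A B.
Proof.
move=> gB AB A1; split=> //; first by move=> x; rewrite inE => /eqP->.
  by move=> a /AB Ba; exists 1; rewrite ?inE// invg1 mul1g.
by move=> x y; rewrite !inE => /eqP-> /eqP->.
Qed.

Lemma fin_idx_self A B : subgroup B -> A `<=` B -> A 1 -> fin_idx A B.
Proof. by move=> gB AB A1; apply: coset_reps_fin (coset_reps_self gB AB A1). Qed.

Lemma idx_self A B : subgroup B -> A `<=` B -> A 1 -> idx A B = 1%N.
Proof. by move=> gB AB A1; rewrite (coset_reps_idx gB (coset_reps_self gB AB A1)). Qed.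

Lemma coset_repsIr s A B : subgroup A -> coset_reps s A B -> coset_reps s A (A `&` B).
Proof.
move=> gA [us sA As sI]; split => //.
  move=> a Aa; have [x xs Bx] := As _ Aa; exists x => //; split => //.
  by apply: subgroupM => //; apply: subgroupV => //; exact: sA.
by move=> x y xs ys [_]; exact: sI.
Qed.

Lemma fin_idxIr A B : subgroup A -> subgroup B -> fin_idx A B -> fin_idx A (A `&` B).
Proof.
move=> gA gB /(coset_reps_ex gB)[s] /(coset_repsIr gA) ts.
exact: (coset_reps_fin (subgroupI gA gB) ts).
Qed.

Lemma idxIr A B : subgroup A -> subgroup B -> fin_idx A B -> idx A (A `&` B) = idx A B.
Proof.
move=> gA gB /(coset_reps_ex gB)[s] ts.
by rewrite (coset_reps_idx gB ts) (coset_reps_idx (subgroupI gA gB) (coset_repsIr gA ts)).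
Qed.

Lemma idx_gt0 A B : subgroup B -> fin_idx A B -> A 1 -> (0 < idx A B)%N.
Proof.
move=> gB /(coset_reps_ex gB)[s ts] A1; rewrite (coset_reps_idx gB ts).
by have [_ _ /(_ _ A1)[x]] := ts; case: s ts.
Qed.

Lemma idx_subset_r A B C : subgroup C -> B `<=` C -> fin_idx A B -> subgroup B ->
  fin_idx A C /\ (idx A C <= idx A B)%N.
Proof.
move=> gC BC fB gB.
have e : cosets A C = (fun X : set G => [set x * w | x in X & w in C]) @` cosets A B.
  have h x : [set x * w | x in lcos B x & w in C] = lcos C x.
    apply/seteqP; split=> [_ [_ [b /BC Cb <-] [w Cw <-]]|_ [w Cw <-]].
      by exists (b * w); [exact: subgroupM | rewrite mulgA].
    by exists x; [exists 1; [exact: subgroup1 | rewrite mulg1] | exists w].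
  by rewrite /cosets image_comp; apply: eq_imagel => x _ /=; rewrite h.
have f := finite_image (fun X : set G => [set x * w | x in X & w in C]) fB.
rewrite /fin_idx /idx e; split => //.
by rewrite fset_set_image//; rewrite (leq_trans (leq_imfset_card _ _ _)).
Qed.

End Index.

(** * Calculus of indices, and compactness *)

Section IndexCalculus.
Local Open Scope group_scope.
Variable G : topologicalGroupType.
Implicit Types (A B C U V K : set G) (s t : seq G).

Lemma idx_trans A B C : subgroup A -> subgroup B -> subgroup C ->
  fin_idx A B -> fin_idx B C -> fin_idx A C /\ (idx A C <= idx A B * idx B C)%N.
Proof.
move=> gA gB gC fAB fBC.
have fABC : fin_idx (A `&` B) C by apply: fin_idx_subset_l fBC => x [].
have fABC' := fin_idxI gA gB gC fAB fABC.
have [fAC le] := idx_subset_r gC (@subIsetr _ B C) fABC' (subgroupI gB gC).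
split => //; apply: (leq_trans le);
  rewrite idxI// leq_mul2l idx_subset_l ?orbT//.
Qed.

Lemma idx_tower A B C : subgroup A -> subgroup B -> subgroup C ->
  C `<=` B -> B `<=` A -> fin_idx A B -> fin_idx B C ->
  idx A C = (idx A B * idx B C)%N.
Proof.
move=> gA gB gC CB BA fAB fBC.
have e1 : B `&` C = C by rewrite setIC; apply/setIidPl.
have e2 : A `&` B = B by rewrite setIC; apply/setIidPl.
by rewrite -{1}e1 idxI// e2.
Qed.

(** The ratio of |A : A ∩ B| and |B : A ∩ B| is a cocycle on commensurable
subgroups, since both indices may be replaced by those of [A ∩ B ∩ C]. *)
Lemma idx_cocycle A B C : subgroup A -> subgroup B -> subgroup C ->
  fin_idx A B -> fin_idx B A -> fin_idx B C -> fin_idx C B ->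
  fin_idx A C -> fin_idx C A ->
  (idx A B * idx B C * idx C A = idx B A * idx C B * idx A C)%N.
Proof.
move=> gA gB gC AB BA BC CB AC CA.
have key (X Y Z : set G) : subgroup X -> subgroup Y -> subgroup Z ->
    fin_idx X Y -> fin_idx X Z ->
    (idx X Y * idx (X `&` Y) Z = idx X Z * idx (X `&` Z) Y)%N.
  move=> gX gY gZ XY XZ; rewrite -!idxI// 1?setIC//.
    by apply: fin_idx_subset_l XY => x [].
  by apply: fin_idx_subset_l XZ => x [].
have pos (X Y Z : set G) : subgroup X -> subgroup Y -> subgroup Z -> fin_idx X Z ->
    (0 < idx (X `&` Y) Z)%N.
  move=> gX gY gZ XZ; apply: idx_gt0 => //; last by split; exact: subgroup1.
  by apply: fin_idx_subset_l XZ => x [].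
have := key _ _ _ gA gB gC AB AC; have := key _ _ _ gB gC gA BC BA.
have := key _ _ _ gC gA gB CA CB.
have := pos _ _ _ gA gB gC AC; have := pos _ _ _ gA gC gB AB.
have := pos _ _ _ gB gC gA BA.
rewrite ![B `&` A]setIC ![C `&` _]setIC.
move: (idx (A `&` B) C) (idx (A `&` C) B) (idx (B `&` C) A) => x y z x0 y0 z0 e1 e2 e3.
apply/eqP; rewrite -(@eqn_pmul2r (x * y * z)) ?muln_gt0 ?x0 ?y0 ?z0//;
  apply/eqP.
transitivity ((idx A B * x) * (idx B C * z) * (idx C A * y))%N; first by ring.
by rewrite e1 e2 e3; ring.
Qed.

Lemma coset_reps_image (f : G -> G) s A B : {morph f : x y / x * y} -> injective f ->
  coset_reps s A B -> coset_reps (map f s) (f @` A) (f @` B).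
Proof.
move=> fM fI [us sA As sI].
have f1 : f 1 = 1 by apply: (mulgI (f 1)); rewrite -fM !mulg1.
have fV x : f x^-1 = (f x)^-1 by apply: (mulgI (f x)); rewrite -fM !mulgV.
split.
- by rewrite map_inj_uniq.
- by move=> x /mapP[y /sA Ay ->]; exists y.
- move=> _ [a Aa <-]; have [x xs Bx] := As _ Aa.
  by exists (f x); [exact: map_f | exists (x^-1 * a); rewrite // fM fV].
- move=> _ _ /mapP[x xs ->] /mapP[y ys ->] [b Bb]; rewrite -fV -fM => /fI e.
  by rewrite (sI x y)// -e.
Qed.

Lemma subgroup_image (f : G -> G) A : {morph f : x y / x * y} ->
  subgroup A -> subgroup (f @` A).
Proof.
move=> fM [A1 AM].
have f1 : f 1 = 1 by apply: (mulgI (f 1)); rewrite -fM !mulg1.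
have fV x : f x^-1 = (f x)^-1 by apply: (mulgI (f x)); rewrite -fM !mulgV.
split; first by exists 1.
by move=> _ _ [x Ax <-] [y Ay <-]; exists (x * y^-1); rewrite ?fM ?fV//;
  exact: AM.
Qed.

Lemma idx_image (f : G -> G) A B : {morph f : x y / x * y} -> injective f ->
  subgroup B -> fin_idx A B ->
  fin_idx (f @` A) (f @` B) /\ idx (f @` A) (f @` B) = idx A B.
Proof.
move=> fM fI gB /(coset_reps_ex gB)[s ts].
have ts' := coset_reps_image fM fI ts; have gB' := subgroup_image fM gB.
split; first exact: coset_reps_fin ts'.
by rewrite (coset_reps_idx gB ts) (coset_reps_idx gB' ts') size_map.
Qed.

Lemma mulgl_continuous (x : G) : continuous (fun y : G => x * y).
Proof.
move=> y; apply: (@cvg_comp _ _ _ (fun y => (x, y)) (fun z : G * G => z.1 * z.2) _ (nbhs (x, y))).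
  by apply: cvg_pair => /=; [exact: cvg_cst | exact: cvg_id].
exact: (@mulg_continuous G (_, _)).
Qed.

Lemma mulgr_continuous (x : G) : continuous (fun y : G => y * x).
Proof.
move=> y; apply: (@cvg_comp _ _ _ (fun y => (y, x)) (fun z : G * G => z.1 * z.2) _ (nbhs (y, x))).
  by apply: cvg_pair => /=; [exact: cvg_id | exact: cvg_cst].
exact: (@mulg_continuous G (_, _)).
Qed.

Lemma lcosE B x : lcos B x = (fun y => x^-1 * y) @^-1` B.
Proof.
apply/seteqP; split=> [_ [w Bw <-]|y By] /=; first by rewrite mulKg.
by exists (x^-1 * y) => //; rewrite mulVKg.
Qed.

Lemma open_lcos B x : open B -> open (lcos B x).
Proof. by move=> oB; rewrite lcosE; apply: open_comp => // y _;
  exact: mulgl_continuous. Qed.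

(** The cosets of [B] form an open partition. *)
Lemma compact_fin_idx K B : compact K -> open B -> subgroup B -> fin_idx K B.
Proof.
move=> cK0 oB gB.
(* The unit serves as the base point required by [compact_cover]. *)
pose T : ptopologicalType := HB.pack (G : Type) (Topological.class G) (isPointed.Build G 1).
have : @compact T K by exact: cK0.
rewrite compact_cover => cK.
have [||D DK KD] := cK _ K (lcos B); first by move=> x _; exact: open_lcos.
  by move=> x Kx; exists x => //; exists 1; [exact: subgroup1 | rewrite mulg1].
have : finite_set (lcos B @` [set` D]) by apply: finite_image;
  exact: finite_fset.
apply: sub_finite_set => _ [x Kx <-]; have [y Dy [b Bb e]] := KD _ Kx.
by exists y => //; apply/lcosP => //; rewrite -e mulKg.
Qed.

Lemma open_subgroup_closed B : open B -> subgroup B -> closed B.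
Proof.
move=> oB gB; rewrite -openC.
have -> : ~` B = \bigcup_(x in ~` B) lcos B x.
  apply/seteqP; split=> [x nBx|_ [x nBx [b Bb <-]] Bxb].
    by exists x => //; exists 1; [exact: subgroup1 | rewrite mulg1].
  by apply: nBx; exact: (subgroupMr gB Bb).
by apply: bigcup_open => x _; exact: open_lcos.
Qed.

Lemma index_capE U V : subgroup U -> subgroup V -> fin_idx U V -> index_cap U V = idx U V.
Proof. by move=> gU gV fUV; rewrite -idxIr. Qed.

Lemma compact_nested (T : topologicalType) (K : nat -> set T) : compact (K 0%N) ->
  (forall n, closed (K n)) -> (forall n, K n.+1 `<=` K n) ->
  (forall n, K n !=set0) -> exists x, forall n, K n x.
Proof.
move=> cK clK KS Kn.
have Kle m n : (m <= n)%N -> K n `<=` K m.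
  by elim: n => [|n ih]; rewrite leq_eqVlt => /predU1P[->//|//];
    move/ih=> h x /KS; exact: h.
pose F := filter_from [set: nat] K.
have FF : ProperFilter F.
  apply: filter_from_proper => //; apply: filter_from_filter;
    first by exists 0%N.
  move=> i j _ _; exists (maxn i j) => // x Kx.
  by split; apply: Kle Kx; rewrite ?leq_maxl ?leq_maxr.
have [|x [_ clx]] := cK F FF; first by exists 0%N.
exists x => n; apply: clK; move: clx; rewrite clusterE; apply.
by exists n.
Qed.

End IndexCalculus.

(** * The scale as a growth rate *)

Lemma finite_uniform (I : eqType) (s : seq I) (P : I -> nat -> Prop) :
  (forall i, i \in s -> exists n, forall m, (n <= m)%N -> P i m) ->
  exists n, forall i, i \in s -> forall m, (n <= m)%N -> P i m.
Proof.
elim: s => [|i s ih] h; first by exists 0%N.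
have [|n hn] := ih; first by move=> j js; apply: h; rewrite inE js orbT.
have [k hk] := h i (mem_head _ _); exists (maxn n k) => j.
by rewrite inE => /predU1P[->|js] m; rewrite geq_max => /andP[? ?];
  [apply: hk | apply: hn].
Qed.

Section Willis.
Local Open Scope group_scope.
Variable G : topologicalGroupType.
Implicit Types (A B C U V W K S : set G).

Lemma least_nat (A : set nat) a : A a -> A (least 0%N A) /\ (least 0%N A <= a)%N.
Proof.
move=> Aa; have [m [Am mA]] : exists m, A m /\ forall k, A k -> (m <= k)%N.
  have [|m /asboolP Am mA] := @ex_minnP (fun k => `[< A k >]);
    first by exists a; apply/asboolP.
  by exists m; split=> // k Ak; apply: mA; apply/asboolP.
have : (A `&` lbound A) m by split => // k; exact: mA.
by rewrite /least; case: xgetP => [x _ [Ax lx] _|/(_ m)//]; split => //;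
  exact: lx.
Qed.

Lemma COS_fin_idx U V : COS U -> COS V -> fin_idx U V.
Proof. by move=> [_ cU _] [gV _ oV]; exact: compact_fin_idx. Qed.

Lemma open_COS U V : COS V -> subgroup U -> open U -> U `<=` V -> COS U.
Proof.
move=> [_ cV _] gU oU UV; split => //.
by apply: subclosed_compact cV UV; exact: open_subgroup_closed.
Qed.

Lemma supergroup_open A B : open A -> subgroup A -> subgroup B -> A `<=` B -> open B.
Proof.
move=> oA gA gB AB.
have -> : B = \bigcup_(x in B) lcos A x.
  apply/seteqP; split=> [x Bx|_ [x Bx [a /AB Ba <-]]]; last exact: subgroupM.
  by exists x => //; exists 1; [exact: subgroup1 | rewrite mulg1].
by apply: bigcup_open => x _; exact: open_lcos.
Qed.

Lemma compact_mulg A B : compact A -> compact B ->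
  compact [set z.1 * z.2 | z in A `*` B].
Proof.
move=> cA cB; apply: continuous_compact; last exact: compact_setX.
by apply: continuous_subspaceT => z; exact: mulg_continuous.
Qed.

Lemma conj_continuous (c : G) : continuous (fun x => c^-1 * x * c).
Proof.
move=> x; apply: (@cvg_comp _ _ _ (fun x => c^-1 * x) (fun y => y * c) _ (nbhs (c^-1 * x))).
  exact: mulgl_continuous.
exact: mulgr_continuous.
Qed.

Lemma open_all_seq (T : topologicalType) (I : eqType) (s : seq I) (F : I -> set T) :
  (forall i, open (F i)) -> open [set x | forall i, i \in s -> F i x].
Proof.
move=> oF; elim: s => [|i s ih].
  by rewrite (_ : [set _ | _] = setT); [exact: openT | apply/seteqP].
rewrite (_ : [set _ | _] = F i `&` [set x | forall i, i \in s -> F i x]).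
  exact: openI.
apply/seteqP; split=> [x h|x [Fx h] j] /=.
  by split; [apply: h; rewrite inE eqxx | move=> j js; apply: h;
    rewrite inE js orbT].
by rewrite inE => /predU1P[->|/h].
Qed.

Variables al be : G -> G.
Hypothesis alM : {morph al : x y / x * y}.
Hypothesis alK : cancel al be.
Hypothesis beK : cancel be al.
Hypothesis al_cont : continuous al.
Hypothesis be_cont : continuous be.

Lemma beM : {morph be : x y / x * y}.
Proof. by move=> x y; rewrite -[x in LHS]beK -[y in LHS]beK -alM alK. Qed.

Lemma iter_morph (f : G -> G) n : {morph f : x y / x * y} -> {morph iter n f : x y / x * y}.
Proof. by move=> fM x y; elim: n => //= n ->; rewrite fM. Qed.

Lemma morph1 (f : G -> G) : {morph f : x y / x * y} -> f 1 = 1.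
Proof. by move=> fM; apply: (mulgI (f 1)); rewrite -fM !mulg1. Qed.

Lemma morphV (f : G -> G) x : {morph f : x y / x * y} -> f x^-1 = (f x)^-1.
Proof. by move=> fM; apply: (mulgI (f x)); rewrite -fM !mulgV morph1. Qed.

Lemma iter_cancel (f g : G -> G) n : cancel f g -> cancel (iter n f) (iter n g).
Proof. by move=> fK x; elim: n x => // n ih x; rewrite iterSr iterS fK ih. Qed.

Lemma iter_continuous (f : G -> G) n : continuous f -> continuous (iter n f).
Proof.
move=> fc; elim: n => [|n ih] x /=; first exact: cvg_id.
by apply: (@cvg_comp _ _ _ (iter n f) f _ (nbhs (iter n f x)));
  [exact: ih | exact: fc].
Qed.

Lemma image_iter n A : iter n al @` A = iter n be @^-1` A.
Proof.
apply/seteqP; split=> [_ [x Ax <-]|x Ax] /=; first by rewrite iter_cancel.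
by exists (iter n be x) => //; rewrite iter_cancel.
Qed.

Lemma COS_image n U : COS U -> COS (iter n al @` U).
Proof.
move=> [gU cU oU]; split.
- exact: (subgroup_image (iter_morph n alM)).
- by apply: continuous_compact => //; apply: continuous_subspaceT;
  exact: iter_continuous.
- rewrite image_iter; apply: open_comp => // x _; exact: iter_continuous.
Qed.

(** Write [V+] for the intersection of the [al^i V], [i >= 0], and [V-] for that
of the [be^i V]. Then [plus V n] is [al^n V+] and [minus V] is [V-]. *)
Definition plus V n : set G := [set x | forall i, (n <= i)%N -> V (iter i be x)].
Definition minus V : set G := [set x | forall i, V (iter i al x)].
(** When [V = V+ V-], these elements account for the failure of
[al^n V+ ∩ V = V+], hence for the difference between the scale and the index of
[V+] in [al V+]. *)
Definition homoclinic V : set G :=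
  [set x | exists n, forall i, (n <= i)%N -> V (iter i be x) /\ V (iter i al x)].

Section PlusMinus.
Variable V : set G.
Hypothesis gV : subgroup V.

Lemma plus_subgroup n : subgroup (plus V n).
Proof.
split=> [i _|x y Px Py i ni]; first by rewrite (morph1 (iter_morph i beM));
  exact: subgroup1.
rewrite (iter_morph i beM) (morphV _ (iter_morph i beM)).
by apply: gV.2; [exact: Px | exact: Py].
Qed.

Lemma minus_subgroup : subgroup (minus V).
Proof.
split=> [i|x y Nx Ny i]; first by rewrite (morph1 (iter_morph i alM));
  exact: subgroup1.
rewrite (iter_morph i alM) (morphV _ (iter_morph i alM)).
by apply: gV.2; [exact: Nx | exact: Ny].
Qed.

Lemma homoclinic_subgroup : subgroup (homoclinic V).
Proof.
split.
  exists 0%N => i _; rewrite (morph1 (iter_morph i alM)) (morph1 (iter_morph i beM)).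
  by split; exact: subgroup1.
move=> x y [n hx] [m hy]; exists (maxn n m) => i;
  rewrite geq_max => /andP[ni mi].
rewrite (iter_morph i alM) (morphV _ (iter_morph i alM)).
rewrite (iter_morph i beM) (morphV _ (iter_morph i beM)).
have [? ?] := hx _ ni; have [? ?] := hy _ mi.
by split; apply: gV.2.
Qed.

Lemma homoclinic_al x : homoclinic V (al x) <-> homoclinic V x.
Proof.
split=> -[n h]; exists n.+1.
  move=> i ni; split.
    by have [+ _] := h i.+1 (leq_trans (ltnW ni) (leqnSn i));
      rewrite iterSr alK.
  by case: i ni => // i ni; have [_] := h i ni; rewrite -iterSr.
move=> [//|i ni]; split.
  by rewrite iterSr alK; have [] := h i ni.
by rewrite -iterSr; have [] := h i.+2 (leq_trans ni (leq_trans (leqnSn _) (leqnSn _))).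
Qed.

Lemma plus_le n m : (n <= m)%N -> plus V n `<=` plus V m.
Proof. by move=> nm x Px i mi; apply: Px; exact: leq_trans mi. Qed.

Lemma iter_plus n m : iter n al @` plus V m = plus V (n + m).
Proof.
rewrite image_iter; apply/seteqP; split=> x /= h i ni.
  have ni' : (n <= i)%N by apply: leq_trans ni; exact: leq_addr.
  by rewrite -(subnK ni') iterD; apply: h; rewrite leq_subRL.
by rewrite -iterD; apply: h; rewrite addnC leq_add2r.
Qed.

Lemma plus1V : plus V 1 `&` V = plus V 0.
Proof.
apply/seteqP; split=> [x [P1 Vx] [|i] _ //|x P0]; first exact: P1.
by split; [exact: plus_le P0 | exact: (P0 0%N)].
Qed.

Hypothesis cV : compact V.
Hypothesis oV : open V.

(** [S] is used for the whole group and for the group of homoclinic elements. *)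
Variable S : set G.
Hypothesis gS : subgroup S.
Hypothesis Sal : forall x, S (al x) <-> S x.

Lemma iter_stable n x : S (iter n be x) <-> S x.
Proof. by elim: n => //= n <-; rewrite -Sal beK. Qed.

Lemma iter_stableal n x : S (iter n al x) <-> S x.
Proof. by elim: n => //= n <-; rewrite Sal. Qed.

Let J n := S `&` plus V n.

Lemma iterJ n m : iter n al @` (J m) = J (n + m).
Proof.
rewrite image_iter preimage_setI -(image_iter n (plus V m)) iter_plus.
by congr (_ `&` _); apply/seteqP; split=> x /=; rewrite iter_stable.
Qed.

Lemma fin_plus1 : fin_idx (J 1) (J 0).
Proof.
have -> : J 0 = J 1 `&` V by rewrite /J -setIA plus1V.
apply: fin_idxIr => //; first exact: subgroupI (plus_subgroup _).
apply: (@fin_idx_subset_l _ _ (al @` V)).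
  by move=> x [_ P1]; exists (be x); [exact: (P1 1%N) | rewrite beK].
by apply: compact_fin_idx => //; apply: continuous_compact => //;
  exact: continuous_subspaceT.
Qed.

(** The groups [J n] form an increasing chain in which each step is the image of
the first one under a power of [al]. *)
Lemma idx_plus n : fin_idx (J n) (J 0) /\ idx (J n) (J 0) = (idx (J 1) (J 0) ^ n)%N.
Proof.
have gJ k : subgroup (J k) by exact: subgroupI (plus_subgroup _).
elim: n => [|n [fn en]].
  split; first by apply: fin_idx_self => //; exact: subgroup1.
  by rewrite idx_self//; exact: subgroup1.
have [] := idx_image (iter_morph n alM) (can_inj (iter_cancel n alK)) (gJ 0) fin_plus1.
rewrite !iterJ addn0 addn1 => fS eS.
have J0n k m : (k <= m)%N -> J k `<=` J m by move=> km x [Sx Px]; split => //;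
  exact: plus_le Px.
split; first exact: (idx_trans _ _ _ fS fn).1.
by rewrite (idx_tower _ _ _ _ _ fS fn) ?eS ?en ?expnS//; exact: J0n.
Qed.

Lemma idx_plusV n : fin_idx (J n) (plus V 0) /\ idx (J n) (plus V 0) = (idx (J 1) (J 0) ^ n)%N.
Proof.
have gJ : subgroup (J n) by exact: subgroupI (plus_subgroup _).
have [f e] := idx_plus n; rewrite -e.
have e0 : J n `&` plus V 0 = J 0.
  rewrite /J -setIA; congr (_ `&` _); rewrite setIC; apply/setIidPl;
    exact: plus_le.
have [f' _] := idx_subset_r (plus_subgroup 0) (@subIsetr _ S (plus V 0)) f
  (subgroupI gS (plus_subgroup 0)).
by split => //; rewrite -e0 idxIr//; exact: plus_subgroup.
Qed.

End PlusMinus.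

Lemma closed_preimage_iter i V : closed V -> closed (iter i be @^-1` V).
Proof. by move=> clV; apply: closed_comp => // x _; exact: iter_continuous. Qed.

Lemma closed_plus V n : closed V -> closed (plus V n).
Proof.
move=> clV; rewrite (_ : plus V n = \bigcap_(i in [set i | (n <= i)%N]) (iter i be @^-1` V)).
  by apply: closed_bigI => i _; exact: closed_preimage_iter.
by apply/seteqP; split=> x h i; exact: h.
Qed.

(** The intersection of the [al^i V] for [i <= N]. *)
Definition iter_cap V N : set G := [set x | forall i, (i <= N)%N -> V (iter i be x)].

Lemma iter_cap_COS V N : COS V -> COS (iter_cap V N).
Proof.
move=> cV; have [gV cptV oV] := cV.
apply: (open_COS cV); last by move=> x /(_ 0%N); exact.
- split=> [i _|x y hx hy i iN]; first by rewrite (morph1 (iter_morph i beM));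
  exact: subgroup1.
  rewrite (iter_morph i beM) (morphV _ (iter_morph i beM)).
  by apply: gV.2; [exact: hx | exact: hy].
- rewrite (_ : iter_cap V N = [set x | forall i, i \in iota 0 N.+1 -> (iter i be @^-1` V) x]).
    by apply: open_all_seq => i; apply: (@open_comp _ _ (iter i be)) => // x _;
      exact: iter_continuous.
  by apply/seteqP; split=> x h i; have := h i; rewrite mem_iota.
Qed.

Lemma closed_iter_cap V N : closed V -> closed (iter_cap V N).
Proof.
move=> clV; rewrite (_ : iter_cap V N = \bigcap_(i in [set i | (i <= N)%N]) (iter i be @^-1` V)).
  by apply: closed_bigI => i _; exact: closed_preimage_iter.
by apply/seteqP; split=> x h i; exact: h.
Qed.

(** The compact sets [al (iter_cap V N)] decrease to [al V+], which lies in the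
open set [al V+ * V]; one of them already does. *)
Lemma tidy_step V : COS V -> exists N, forall x, iter_cap V N x ->
  exists u y, [/\ plus V 1 u, V y & al x = u * y].
Proof.
move=> cV; have [gV cptV oV] := cV; have clV := open_subgroup_closed oV gV.
apply: contrapT => /forallNP noN.
pose good : set G := [set x | exists u y, [/\ plus V 1 u, V y & x = u * y]].
have og : open good.
  rewrite (_ : good = \bigcup_(u in plus V 1) lcos V u).
    by apply: bigcup_open => u _; exact: open_lcos.
  apply/seteqP; split=> [x [u [y [Pu Vy ->]]]|_ [u Pu [y Vy <-]]].
    by exists u => //; exists y.
  by exists u, y.
pose K n := (be @^-1` iter_cap V n) `&` ~` good.
have [||n x [h ng]|n|x Kx] := @compact_nested _ K.
- apply: (@subclosed_compact _ _ (al @` V)).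
  + apply: closedI; last by rewrite closedC.
    by apply: closed_comp => [x _|]; [exact: be_cont | exact: closed_iter_cap].
  + by apply: continuous_compact => //; exact: continuous_subspaceT.
  + by move=> x [/(_ 0%N) h _]; exists (be x); [exact: h | rewrite beK].
- move=> n; apply: closedI; last by rewrite closedC.
  by apply: closed_comp => [x _|]; [exact: be_cont | exact: closed_iter_cap].
- by split => // i ni; apply: h; exact: leq_trans ni _.
- have /existsNP[x /not_implyP[hx ng]] := noN n.
  exists (al x); split; first by rewrite /= alK.
  by move=> [u [y [Pu Vy e]]]; apply: ng; exists u, y.
have [_ ng] := Kx 0%N; apply: ng; exists x, 1; split; rewrite ?mulg1//;
  last exact: subgroup1.
by move=> [//|i] _; rewrite iterSr; have [h _] := Kx i; exact: h.
Qed.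

(** By [tidy_step], any [y] in [U] can be multiplied by an element of [U+] so that
both the product [z] and [al z] lie in [U]. Applying this to [al^n z] and
pulling back with [be], which preserves [U+], improves the number of forward
images remaining in [U] by one. The set of possible factors in [U+] is compact,
which allows passing to the limit. *)
Lemma tidy_above V : COS V -> exists N, let U := iter_cap V N in
  forall x, U x -> exists u w, [/\ plus U 0 u, minus U w & x = u * w].
Proof.
move=> cV; have [N hN] := tidy_step cV; exists N => U x Ux.
have [gV cptV oV] := cV.
have cU : COS U := iter_cap_COS N cV; have [gU cptU oU] := cU.
have clU := open_subgroup_closed oU gU.
have plusE u : plus V 0 u -> plus U 0 u.
  by move=> Pu i _ j _; rewrite -iterD; exact: Pu.
have step y : U y -> exists u z, [/\ plus U 0 u, U z, U (al z) & y = u * z].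
  move=> Uy; have [u [z [Pu Vz e]]] := hN y Uy.
  have P0u : plus V 0 (be u) by move=> i _; rewrite -iterSr; exact: Pu.
  have Uu := plusE _ P0u.
  have Uz : U (be z).
    have -> : be z = (be u)^-1 * y.
      by rewrite -(alK y) e beM mulKg.
    by apply: (subgroupM gU) => //; apply: (subgroupV gU); exact: (Uu 0%N).
  exists (be u), (be z); split => //; last by rewrite -beM -e alK.
  rewrite beK => -[_ //|i iN].
  by rewrite iterSr; apply: Uz; exact: ltnW.
have decomp n : exists u z, [/\ plus U 0 u, forall i, (i <= n)%N -> U (iter i al z) & x = u * z].
  elim: n => [|n [u [z [Pu Uz e]]]].
    exists 1, x; rewrite mul1g; split => //;
      first exact: subgroup1 (plus_subgroup gU 0).
    by move=> i; rewrite leqn0 => /eqP ->.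
  have [u' [z' [Pu' Uz' Uaz' e']]] := step _ (Uz n (leqnn _)).
  have Pu'' i : (i <= n)%N -> plus U 0 (iter i al (iter n be u')).
    move=> ni j _.
    have -> : iter i al (iter n be u') = iter (n - i) be u'.
      by rewrite -{1}(subnKC ni) iterD iter_cancel.
    by rewrite -iterD; exact: Pu'.
  have P'' : plus U 0 (iter n be u') by exact: (Pu'' 0%N).
  exists (u * iter n be u'), ((iter n be u')^-1 * z); split.
  - exact: (subgroupM (plus_subgroup gU 0)).
  - move=> i; rewrite leq_eqVlt => /predU1P[->|].
      rewrite (iter_morph _ alM) (morphV _ (iter_morph _ alM)) !iterS iter_cancel//.
      by rewrite e' alM mulKg.
    rewrite ltnS => ni; rewrite (iter_morph _ alM) (morphV _ (iter_morph _ alM)).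
    apply: (subgroupM gU); last exact: Uz.
    by apply: (subgroupV gU); exact: (Pu'' _ ni 0%N).
  - by rewrite e mulgA mulgK.
pose K n := plus U 0 `&` [set u | forall i, (i <= n)%N -> U (iter i al (u^-1 * x))].
have clK n : closed (K n).
  apply: closedI; first exact: closed_plus.
  rewrite (_ : [set _ | _] = \bigcap_(i in [set i | (i <= n)%N])
      ((fun u => iter i al (u^-1 * x)) @^-1` U)).
    apply: closed_bigI => i _; apply: closed_comp => // u _.
    apply: (@cvg_comp _ _ _ (fun u => u^-1 * x) (iter i al) _ (nbhs (u^-1 * x))).
      apply: (@cvg_comp _ _ _ (fun u => u^-1) (fun u => u * x) _ (nbhs u^-1)).
        exact: invg_continuous.
      exact: mulgr_continuous.
    exact: iter_continuous.
  by apply/seteqP; split=> u h i; exact: h.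
have [|//|n u [Pu h]|n|u Ku] := @compact_nested _ K.
- by apply: (subclosed_compact _ cptU) => // u [/(_ 0%N) + _]; exact.
- by split => // i ni; apply: h; exact: leqW.
- have [u [z [Pu Uz e]]] := decomp n; exists u; split => // i ni.
  by rewrite e mulKg; exact: Uz.
exists u, (u^-1 * x); split; last by rewrite mulVKg.
  exact: (Ku 0%N).1.
by move=> i; exact: (Ku i).2.
Qed.

(** Let [L] be the group of homoclinic elements and [L+ = L ∩ V+]. The index of
[L+] in [al L+] is finite; as representatives are homoclinic, their images by
[al^m] lie in [V] for all [m] beyond some common [N]. An element of
[al^(N + n) L+] is, modulo [al^N L+], a product of such images. So [L] lies in
[V * al^N V]. *)
Lemma homoclinic_compact V : COS V -> exists2 K, compact K & homoclinic V `<=` K.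
Proof.
move=> cV; have [gV cptV oV] := cV.
have gL := homoclinic_subgroup gV; have Lal := @homoclinic_al V.
have fJ := fin_plus1 gV cptV oV gL.
have [s [us sJ Js sI]] := coset_reps_ex (subgroupI gL (plus_subgroup gV 0)) fJ.
have [N hN] : exists N, forall c, c \in s -> forall m, (N <= m)%N -> V (iter m al c).
  apply: finite_uniform => c /sJ[[n hn] _]; exists n => m nm.
  by have [] := hn m nm.
have key n x : (homoclinic V `&` plus V (N + n)) x ->
    exists2 w, V w & exists2 y, plus V N y & x = w * y.
  elim: n x => [|n ih] x [Lx Px].
    by exists 1; [exact: subgroup1 | exists x; rewrite ?mul1g// -[N]addn0].
  have [|c cs [_ Pc]] := Js (iter (N + n) be x).
    split; first exact/iter_stable.
    move=> i i1; rewrite -iterD; apply: Px.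
    by move: i1; lia.
  have [Lc Pc1] := sJ c cs.
  pose d := iter (N + n) al c.
  have Vd : V d by apply: hN => //; exact: leq_addr.
  have [|w Vw [y Py e]] := ih (d^-1 * x).
    split.
      apply: subgroupM => //; apply: subgroupV => //; exact/iter_stableal.
    rewrite -[(N + n)%N]addn0 -iter_plus image_iter /=.
    by rewrite (iter_morph _ beM) (morphV _ (iter_morph _ beM)) iter_cancel.
  exists (d * w); first exact: subgroupM.
  by exists y => //; rewrite -mulgA -e mulVKg.
exists [set z.1 * z.2 | z in V `*` (iter N al @` V)].
  by apply: compact_mulg => //; have [] := COS_image N cV.
move=> x Lx; have [n hn] := Lx.
have [|w Vw [y Py ->]] := key n x.
  split => // i ni; have [] := hn i _ => //; exact: leq_trans (leq_addl _ _) ni.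
by exists (w, y) => //; split => //=; exists (iter N be y);
  [exact: (Py N) | rewrite iter_cancel].
Qed.

(** As [S] meets finitely many cosets of [V], only finitely many conjugates of
[V] by elements of [S] are distinct. *)
Lemma conj_core_COS S V : COS V -> subgroup S -> fin_idx S V ->
  let U := [set x | forall m, S m -> V (m^-1 * x * m)] in
  COS U /\ U `<=` V.
Proof.
move=> cV gS fSV U; have [gV cptV oV] := cV.
have UV : U `<=` V by move=> x /(_ 1 (subgroup1 gS)); rewrite invg1 mul1g mulg1.
split => //; apply: (open_COS cV) => //.
- split; first by move=> m _; rewrite mulg1 mulVg; exact: subgroup1.
  move=> x y hx hy m Sm.
  have -> : m^-1 * (x * y^-1) * m = (m^-1 * x * m) * (m^-1 * y * m)^-1.
    by rewrite !invgM invgK !mulgA mulgK.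
  by apply: gV.2; [exact: hx | exact: hy].
have [s [us sS Ss _]] := coset_reps_ex gV fSV.
have -> : U = [set x | forall c, c \in s -> ((fun x => c^-1 * x * c) @^-1` V) x].
  apply/seteqP; split=> x h; first by move=> c /sS; exact: h.
  move=> m Sm; have [c cs Vv] := Ss m Sm.
  have -> : m^-1 * x * m = (c^-1 * m)^-1 * (c^-1 * x * c) * (c^-1 * m).
    by rewrite !invgM invgK !mulgA !mulgK.
  apply: subgroupM => //; apply: subgroupM => //; first exact: subgroupV.
  exact: h.
apply: open_all_seq => c; apply: (@open_comp _ _ (fun x => c^-1 * x * c)) => // x _.
exact: conj_continuous.
Qed.

(** Let [L] be the group of homoclinic elements for [U]. Take [V] inside [U]
normalised by [L] and tidy above, that is [V = V+ V-], and let [L1] in [L] be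
its group of homoclinic elements. Put q = |al V+ : V+| and
qL = |al L1+ : L1+| with [L1+ = L1 ∩ V+].

The group [W = V L] is compact and open, and [al W = al V+ W]. So the index of
[W] in [al W] counts the classes of [al V+] modulo a group containing [al L1+],
whence scale al * qL <= q.

On the other hand |al^n V+ : V+| = q^n factors through [al^n V+ ∩ V]. Since
[V = V- V+], each class of the latter modulo [V+] is represented in [V-], by an
element of [al^n L1+], so there are at most qL^n of them. Together,
(scale al * qL)^n <= q^n <= |al^n V+ : V| * qL^n. *)
Theorem scale_growth U : COS U -> exists V, [/\ COS V, V `<=` U &
  forall n, (scale al ^ n <= idx (plus V n) V)%N].
Proof.
move=> cU; have [gU cptU oU] := cU.
have gL := homoclinic_subgroup gU; have Lal := @homoclinic_al U.
set L := homoclinic U in gL Lal.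
have [K cK LK] := homoclinic_compact cU.
have fL A : open A -> subgroup A -> fin_idx L A.
  by move=> oA gA; apply: (fin_idx_subset_l LK); exact: compact_fin_idx.
have [cV0 V0U] := conj_core_COS cU gL (fL _ oU gU).
set V0 := [set x | _] in cV0 V0U.
have [N tidy] := tidy_above cV0.
have cV : COS (iter_cap V0 N) := iter_cap_COS N cV0.
have Vnorm m x : L m -> iter_cap V0 N x -> iter_cap V0 N (m^-1 * x * m).
  move=> Lm Vx i iN; rewrite !(iter_morph _ beM) (morphV _ (iter_morph _ beM)) => c Lc.
  have := Vx i iN (iter i be m * c).
  by rewrite invgM !mulgA; apply; apply: subgroupM => //; exact/iter_stable.
have VV0 : iter_cap V0 N `<=` V0 by move=> x /(_ 0%N); exact.
move: (iter_cap V0 N) tidy cV Vnorm VV0 => V tidy cV Vnorm VV0.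
have [gV cptV oV] := cV; have VU := subset_trans VV0 V0U.
exists V; split => //.
have gL1 := homoclinic_subgroup gV; have L1al := @homoclinic_al V.
have L1L : homoclinic V `<=` L.
  by move=> x [n h]; exists n => i ni; have [? ?] := h i ni; split; exact: VU.
set L1 := homoclinic V in gL1 L1al L1L.
(* Adjoining [L] to [V] absorbs the homoclinic part of [al V+]. *)
pose W := [set z.1 * z.2 | z in V `*` L].
have Wmul x y : V x -> L y -> W (x * y) by move=> Vx Ly; exists (x, y).
have VW : V `<=` W by move=> x Vx; rewrite -[x]mulg1; apply: Wmul => //;
  exact: subgroup1.
have LW : L `<=` W by move=> x Lx; rewrite -[x]mul1g; apply: Wmul => //;
  exact: subgroup1.
have gW : subgroup W.
  split; first by apply: VW; exact: subgroup1.
  move=> _ _ [[v m] /= [Vv Lm] <-] [[v' m'] /= [Vv' Lm'] <-].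
  have -> : v * m * (v' * m')^-1 =
      (v * ((m * m'^-1)^-1^-1 * v'^-1 * (m * m'^-1)^-1)) * (m * m'^-1).
    by rewrite invgK -[RHS]mulgA mulgVK invgM !mulgA.
  have Lmm : L (m * m'^-1) by exact: gL.2.
  apply: Wmul => //; apply: subgroupM => //.
  by apply: Vnorm; exact: subgroupV.
have oW : open W := supergroup_open oV gV gW VW.
have cW : COS W.
  split => //; apply: (@subclosed_compact _ _ [set z.1 * z.2 | z in V `*` K]).
  - exact: open_subgroup_closed.
  - exact: compact_mulg.
  - by move=> _ [[v m] [Vv Lm] <-]; exists (v, m) => //; split => //; exact: LK.
have gP n := plus_subgroup gV n.
have TS x : [set: G] (al x) <-> [set: G] x by [].
have gT : subgroup [set: G] by [].
pose q := idx (plus V 1) (plus V 0).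
have qE n : fin_idx (plus V n) (plus V 0) /\ idx (plus V n) (plus V 0) = (q ^ n)%N.
  by have := idx_plus gV cptV oV gT TS n; rewrite !setTI.
pose qL := idx (L1 `&` plus V 1) (L1 `&` plus V 0).
have qLE n : fin_idx (L1 `&` plus V n) (plus V 0) /\
    idx (L1 `&` plus V n) (plus V 0) = (qL ^ n)%N.
  exact: idx_plusV.
have qL0 : (0 < qL)%N.
  rewrite -[qL]expn1 -(qLE 1%N).2; apply: idx_gt0 => //;
    first exact: (qLE 1%N).1.
  by apply: subgroup1; exact: subgroupI.
have fPA n A : open A -> subgroup A -> fin_idx (plus V n) A.
  move=> oA gA; apply: (@fin_idx_subset_l _ _ (iter n al @` V)).
    by rewrite image_iter => x Px; exact: Px.
  by apply: compact_fin_idx => //; have [] := COS_image n cV.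
have PV : plus V 0 `<=` V by move=> x /(_ 0%N); exact.
have s_le : (scale al * qL <= q)%N.
  have cW1 := COS_image 1 cW.
  have gW1 : subgroup (al @` W) by case: cW1.
  have fWW : fin_idx (al @` W) W := COS_fin_idx cW1 cW.
  have [_ le1] := least_nat (ex_intro2 _ _ W cW (erefl (index_cap (al @` W) W))
    : [set index_cap (al @` U) U | U in @COS G] _).
  rewrite index_capE// in le1.
  have le2 : (idx (al @` W) W <= idx (plus V 1) W)%N.
    apply: idx_cosubl; [by [] | | exact: fPA].
    move=> _ [_ [[v m] /= [Vv Lm] <-] <-].
    have [u [w [Pu Nw ->]]] := tidy v Vv.
    exists (al u); first by rewrite -[1%N]addn0 -iter_plus; exists u.
    rewrite !alM !mulgA mulVg mul1g; apply: Wmul; first exact: (Nw 1%N).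
    exact/Lal.
  have fP1 : fin_idx (plus V 1 `&` W) (plus V 0).
    by apply: fin_idx_subset_l (qE 1%N).1 => x [].
  have qW : q = (idx (plus V 1) W * idx (plus V 1 `&` W) (plus V 0))%N.
    rewrite -idxI//; last exact: fPA.
    by rewrite /q; congr idx; apply/esym; rewrite setIC;
      apply/setIidPl => x /PV/VW.
  rewrite qW; apply: leq_mul; first exact: leq_trans le2.
  rewrite -[qL]expn1 -(qLE 1%N).2; apply: idx_subset_l => // x [L1x Px].
  by split => //; apply/LW/L1L.
move=> n.
have fPn : fin_idx (plus V n `&` V) (plus V 0).
  by apply: fin_idx_subset_l (qE n).1 => x [].
have qn : (q ^ n = idx (plus V n) V * idx (plus V n `&` V) (plus V 0))%N.
  rewrite -idxI//; last exact: fPA.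
  rewrite -(qE n).2; congr idx; apply/esym; rewrite setIC;
    apply/setIidPl => x /PV//.
have le3 : (idx (plus V n `&` V) (plus V 0) <= qL ^ n)%N.
  rewrite -(qLE n).2; apply: idx_cosubl; [by [] | | exact: (qLE n).1].
  move=> x [Px Vx]; have [u [w [Pu Nw e]]] := tidy x^-1 (subgroupV gV Vx).
  have Nw' : minus V w^-1 by exact: (subgroupV (minus_subgroup gV)).
  have xE : x = w^-1 * u^-1 by rewrite -[x]invgK e invgM.
  have Pw : plus V n w^-1.
    rewrite -(mulgK u^-1 w^-1) -xE invgK; apply: (subgroupM (gP n)) => //.
    exact: plus_le Pu.
  exists w^-1; last by rewrite xE mulKg; exact: (subgroupV (gP 0%N)).
  split => //; exists n => i ni; split; [exact: Pw | exact: Nw'].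
rewrite -(@leq_pmul2r (qL ^ n)) ?expn_gt0 ?qL0// -expnMn.
apply: (@leq_trans (q ^ n)); first by case: (n) => // k; rewrite leq_exp2r.
by rewrite qn leq_mul2l le3 orbT.
Qed.

End Willis.

(** * Quasi-geodesic orbits under the four-point inequality *)

Local Open Scope ring_scope.

Section FourPoint.
Variables (R : realType) (X : metricType R) (delta : R).
Implicit Types (x y z p : X) (u v w : nat -> X) (r : R -> X).
Notation d := (@mdist R X).
Notation gp := (@gromov_product R X).
Notation eqv := (@equivalent_at_infinity R X).
Hypothesis four : forall x y z p, gp p x y >= Num.min (gp p x z) (gp p y z) - delta.

Lemma delta_ge0 x : 0 <= delta.
Proof. by have := four x x x x; rewrite /Num.min ltxx; lra. Qed.

Lemma gp_ge M p x y z : M <= gp p x z -> M <= gp p y z -> M - delta <= gp p x y.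
Proof.
move=> h1 h2; apply: le_trans (four x y z p); rewrite lerD2r.
by rewrite /Num.min; case: ifP.
Qed.

(** The symmetric form of the four-point inequality: of the three sums of
opposite distances, the largest is almost attained twice. *)
Lemma four_dist x y z p :
  d x y + d z p <= d x z + d y p + 2 * delta \/
  d x y + d z p <= d x p + d y z + 2 * delta.
Proof.
have := four x y z p; rewrite /Num.min /gromov_product.
by case: ifP => _; [left | right]; lra.
Qed.

Lemma gpC p x y : gp p x y = gp p y x.
Proof. by rewrite /gromov_product (metric_sym x y) (addrC (d x p)). Qed.

Lemma gp_le p x y : gp p x y <= d x p.
Proof. by rewrite /gromov_product; have := metric_triangle y x p;
  rewrite (metric_sym y x); lra. Qed.

Lemma gp_base p q x y : gp p x y <= gp q x y + d p q.
Proof.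
rewrite /gromov_product; have := metric_triangle x q p;
  have := metric_triangle y q p.
by rewrite (metric_sym q p); lra.
Qed.

Lemma gp_lipschitz p x x' y : gp p x y <= gp p x' y + d x x'.
Proof.
rewrite /gromov_product; have := metric_triangle x x' p.
have := metric_triangle x' x y; rewrite (metric_sym x' x); lra.
Qed.

Section Isometry.
Variable f : X -> X.
Hypothesis fI : forall x y, d (f x) (f y) = d x y.

Lemma iter_isometry n x y : d (iter n f x) (iter n f y) = d x y.
Proof. by elim: n => //= n ih; rewrite fI. Qed.

Lemma iter_dist x i j : d (iter i f x) (iter (i + j) f x) = d x (iter j f x).
Proof. by rewrite iterD iter_isometry. Qed.

Lemma iter_dist_le x n : d x (iter n f x) <= n%:R * d x (f x).
Proof.
elim: n => [|n ih]; first by rewrite mul0r mdistxx.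
have := metric_triangle x (iter n f x) (iter n.+1 f x).
by rewrite -{2}addn1 iter_dist /= -[n.+1]addn1 natrD; lra.
Qed.

(** Linear growth forces some power [f^N] to satisfy
[a (2 N) >= a N + 3 delta + 1], since otherwise [a] would grow logarithmically
along powers of 2. For such a power the four-point inequality excludes
backtracking: first the displacements [A n = a (n N)] increase by more than
[delta] at each step, then two consecutive pieces almost add up. *)
Lemma orbit_quasigeodesic x (c C : R) : 0 < c -> 0 <= C ->
  (forall n, c * n%:R - C <= d x (iter n f x)) ->
  exists K, forall m n, d x (iter m f x) + d x (iter n f x) <= d x (iter (m + n) f x) + K.
Proof.
move=> c0 C0 lin; pose a n := d x (iter n f x).
have d0 := delta_ge0 x.
have a0 : a 0%N = 0 by rewrite /a mdistxx.
have apos n : 0 <= a n by exact: mdist_ge0.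
have aD m n : a (m + n)%N <= a m + a n.
  by have := metric_triangle x (iter m f x) (iter (m + n) f x);
    rewrite iter_dist.
have dE i j : (i <= j)%N -> d (iter i f x) (iter j f x) = a (j - i)%N.
  by move=> ij; rewrite -{1}(subnKC ij) iter_dist.
have [N N0 aN] : exists2 N, (0 < N)%N & a N + 3 * delta + 1 <= a (N + N)%N.
  apply: contrapT => /forall2NP noN.
  have grow k : a (2 ^ k)%N <= a 1%N + k%:R * (3 * delta + 1).
    elim: k => [|k ih]; first by rewrite expn0 mul0r addr0.
    have [|] := noN (2 ^ k)%N; first by rewrite expn_gt0.
    rewrite addnn -mul2n -expnS => /negP; rewrite -ltNge.
    by rewrite -[k.+1]addn1 natrD; lra.
  (* [2 ^ (2 j) >= j ^ 2] beats any linear function of [j]. *)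
  pose j := (Num.truncn ((C + a 1%N + 2 * (3 * delta + 1)) / c)).+1.
  have jb : C + a 1%N + 2 * (3 * delta + 1) < c * j%:R.
    by rewrite [c * _]mulrC -ltr_pdivrMr//; exact: truncnS_gt.
  have := lin (2 ^ (j + j))%N; have := grow (j + j)%N; rewrite -/(a _) => h1 h2.
  have j1 : 1 <= j%:R :> R by rewrite ler1n.
  have jj : j%:R * j%:R <= (2 ^ (j + j))%:R :> R.
    rewrite expnD natrM; apply: ler_pM => //; rewrite ler_nat;
      exact: ltnW (ltn_expl _ _).
  have h3 : c * (j%:R * j%:R) <= c * (2 ^ (j + j))%:R by rewrite ler_pM2l.
  have h4 : j%:R * (C + a 1%N + 2 * (3 * delta + 1)) <= j%:R * (c * j%:R).
    by rewrite ler_pM2l ?ltW//; lra.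
  have h5 : 0 <= (j%:R - 1) * (C + a 1%N) by rewrite mulr_ge0//;
    [lra | have := apos 1%N; lra].
  have h6 : C + a 1%N + 2 * (3 * delta + 1) * j%:R < j%:R * (c * j%:R).
    have : j%:R * (C + a 1%N + 2 * (3 * delta + 1)) < j%:R * (c * j%:R).
      by rewrite ltr_pM2l//; lra.
    nra.
  rewrite natrD in h1; nra.
pose A n := a (n * N)%N.
have AE i j : (i <= j)%N -> d (iter (i * N) f x) (iter (j * N) f x) = A (j - i)%N.
  by move=> ij; rewrite dE ?leq_mul2r ?ij ?orbT// -mulnBl.
have A1 : A 1%N = a N by rewrite /A mul1n.
have A2 : A 2%N = a (N + N)%N by rewrite /A mul2n addnn.
have A0 : A 0%N = 0 by rewrite /A mul0n.
(* Four points 0, 1, 2, n + 2 of the orbit of [f^N]. *)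
have Ainc n : A n + delta + 1 <= A n.+1.
  elim: n => [|n ih].
    by rewrite A0 A1; have := aD N N; lra.
  have := four_dist (iter (0 * N) f x) (iter (2 * N) f x) (iter (1 * N) f x) (iter (n.+2 * N) f x).
  rewrite (metric_sym (iter (2 * N) f x) (iter (1 * N) f x)) !AE// !subn0 !subSS !subn0.
  have := apos N; rewrite A1 A2; case; lra.
(* Four points 0, m, m + 1, m + n of the orbit of [f^N]. *)
have Aqg m n : A m + A n <= A (m + n)%N + A 1%N + 2 * delta.
  case: n => [|n]; first by rewrite addn0 A0 A1; have := apos N; lra.
  have := four_dist (iter (0 * N) f x) (iter (m.+1 * N) f x)
    (iter (m * N) f x) (iter ((m + n.+1) * N) f x).
  rewrite (metric_sym (iter (m.+1 * N) f x) (iter (m * N) f x)) !AE//; try lia.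
  rewrite !subn0 addKn subSn// subnn addnS subSS addKn.
  have := Ainc m; have := Ainc n; case; lra.
(* The remainders modulo [N] change the displacements by at most [E]. *)
pose E := N%:R * d x (f x).
have aE (r : nat) : (r < N)%N -> a r <= E.
  move=> rN; apply: (le_trans (iter_dist_le x r)); apply: ler_wpM2r;
    first exact: mdist_ge0.
  by rewrite ler_nat ltnW.
exists (A 1%N + 2 * delta + 4 * E) => m n; rewrite -!/(a _).
have aT i j : a i <= a (i + j)%N + a j.
  have := metric_triangle x (iter (i + j) f x) (iter i f x).
  by rewrite (metric_sym (iter (i + j) f x)) iter_dist.
have hm := ltn_pmod m N0; have hn := ltn_pmod n N0.
have := aD (m %/ N * N)%N (m %% N)%N; have := aD (n %/ N * N)%N (n %% N)%N.
rewrite -!divn_eq.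
have := aT ((m %/ N + n %/ N) * N)%N (m %% N + n %% N)%N.
have -> : ((m %/ N + n %/ N) * N + (m %% N + n %% N) = m + n)%N.
  by rewrite mulnDl addnACA -!divn_eq.
have := aD (m %% N)%N (n %% N)%N.
have := Aqg (m %/ N)%N (n %/ N)%N.
have := aE _ hm; have := aE _ hn; rewrite /A; lra.
Qed.

End Isometry.

End FourPoint.

(** * Boundary points and attracting points *)

Section Boundary.
Variables (R : realType) (X : metricType R) (delta : R).
Implicit Types (x y z p : X) (u v w : nat -> X) (r : R -> X).
Notation d := (@mdist R X).
Notation gp := (@gromov_product R X).
Notation eqv := (@equivalent_at_infinity R X).
Hypothesis four : forall x y z p, gp p x y >= Num.min (gp p x z) (gp p y z) - delta.

Lemma equivalent_from_base p u v : (forall M, exists N, forall i j, (N <= i)%N -> (N <= j)%N ->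
    M <= gp p (u i) (v j)) -> eqv u v.
Proof.
move=> h q M; have [N hN] := h (M + d p q); exists N => i j iN jN.
by have := hN i j iN jN; have := gp_base p q (u i) (v j); lra.
Qed.

Lemma eqv_sym u v : eqv u v -> eqv v u.
Proof.
move=> h p M; have [N hN] := h p M; exists N => i j iN jN.
by rewrite gpC; exact: hN.
Qed.

Lemma eqv_trans u v w : eqv u v -> eqv v w -> eqv u w.
Proof.
move=> huv hvw p M; have [N hN] := huv p (M + delta);
  have [N' hN'] := hvw p (M + delta).
exists (maxn N N') => i j; rewrite !geq_max => /andP[iN iN'] /andP[jN jN'].
have := hN i (maxn N N') iN (leq_maxl _ _).
have := hN' (maxn N N') j (leq_maxr _ _) jN'; rewrite (gpC _ _ (w j)) => h1 h2.
by have := gp_ge four h2 h1; lra.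
Qed.

Lemma eqv_close u u' v (D : R) : (forall n, d (u n) (u' n) <= D) -> eqv u v -> eqv u' v.
Proof.
move=> close h p M; have [N hN] := h p (M + D); exists N => i j iN jN.
by have := hN i j iN jN; have := gp_lipschitz p (u i) (u' i) (v j);
  have := close i; lra.
Qed.

Lemma eqv_shift u v : eqv u v -> eqv (fun n => u n.+1) v.
Proof.
by move=> h p M; have [N hN] := h p M; exists N => i j iN; apply: hN;
  exact: leqW.
Qed.

Lemma gp_isometry (f : X -> X) p x y : (forall x y, d (f x) (f y) = d x y) ->
  gp (f p) (f x) (f y) = gp p x y.
Proof. by move=> fI; rewrite /gromov_product !fI. Qed.

Lemma eqv_isometry (f : X -> X) u v : (forall x y, d (f x) (f y) = d x y) ->
  eqv u v -> eqv (f \o u) (f \o v).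
Proof.
move=> fI h; apply: (@equivalent_from_base (f (u 0%N))) => M.
by have [N hN] := h (u 0%N) M; exists N => i j iN jN; rewrite /= gp_isometry//;
  exact: hN.
Qed.

(** If some pair of arbitrarily far terms has product below [M], the four-point
inequality propagates this bound to all far pairs, because the products within
each sequence are large. Terms near the beginning contribute a bounded
amount. *)
Lemma not_eqv_bounded p u v : eqv u u -> eqv v v -> ~ eqv u v ->
  exists B, forall i j, gp p (u i) (v j) <= B.
Proof.
move=> huu hvv nuv.
have [M hM] : exists M, forall N, exists i j, [/\ (N <= i)%N, (N <= j)%N & gp p (u i) (v j) < M].
  apply: contrapT => /forallNP h; apply: nuv;
    apply: (@equivalent_from_base p) => M.
  have /existsNP[N hN] := h M; exists N => i j iN jN.
  by rewrite leNgt; apply/negP => lt; apply: hN; exists i, j.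
have [N1 hN1] := huu p (M + 2 * delta + 1);
  have [N2 hN2] := hvv p (M + 2 * delta + 1).
pose N := maxn N1 N2.
have far i j : (N <= i)%N -> (N <= j)%N -> gp p (u i) (v j) <= M + 2 * delta.
  rewrite !geq_max => /andP[iN1 iN2] /andP[jN1 jN2].
  have [i' [j' []]] := hM N; rewrite !geq_max => /andP[i'N1 i'N2] /andP[j'N1 j'N2] lt.
  rewrite leNgt; apply/negP => gt.
  have h1 := hN1 i' i i'N1 iN1; have h2 := hN2 j' j j'N2 jN2.
  have h3 : M + 2 * delta <= gp p (v j) (u i) by rewrite gpC; lra.
  have h1' : M + 2 * delta <= gp p (u i') (u i) by lra.
  have h4 := gp_ge four h1' h3.
  have h2' : M + 2 * delta - delta <= gp p (v j') (v j).
    by have := delta_ge0 four p; lra.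
  have h5 := gp_ge four h4 h2'; lra.
pose S := \sum_(i < N) (d (u i) p + d (v i) p).
have S0 : 0 <= S by apply: sumr_ge0 => i _; rewrite addr_ge0// mdist_ge0.
have Si i : (i < N)%N -> d (u i) p + d (v i) p <= S.
  move=> iN; rewrite /S (bigD1 (Ordinal iN))//= lerDl.
  by apply: sumr_ge0 => j _; rewrite addr_ge0// mdist_ge0.
exists (`|M + 2 * delta| + S) => i j.
have := ler_norm (M + 2 * delta) => hn.
have [iN|iN] := leqP N i; last first.
  have := Si _ iN; have := gp_le p (u i) (v j); have := mdist_ge0 (v i) p.
  by have := normr_ge0 (M + 2 * delta); lra.
have [jN|jN] := leqP N j; last first.
  have := Si _ jN; rewrite gpC; have := gp_le p (v j) (u i);
    have := mdist_ge0 (u j) p.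
  by have := normr_ge0 (M + 2 * delta); lra.
by have := far i j iN jN; lra.
Qed.

Definition ray_seq r : nat -> X := fun n => r n%:R.

Lemma ray_gp r s t : geodesic_ray r -> 0 <= s -> s <= t -> gp (r 0) (r s) (r t) = s.
Proof.
move=> rr s0 st; have t0 := le_trans s0 st.
rewrite /gromov_product !rr// !subr0 (ger0_norm s0) (ger0_norm t0).
by rewrite ler0_norm; lra.
Qed.

Lemma ray_eqv r : geodesic_ray r -> eqv (ray_seq r) (ray_seq r).
Proof.
move=> rr; apply: (@equivalent_from_base (r 0)) => M.
exists (Num.truncn M).+1 => i j iN jN.
have Mi : M <= i%:R by apply: (le_trans (ltW (truncnS_gt M))); rewrite ler_nat.
have Mj : M <= j%:R by apply: (le_trans (ltW (truncnS_gt M))); rewrite ler_nat.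
rewrite /ray_seq; have [ij|/ltnW ji] := leqP i j.
  by rewrite ray_gp// ?ler_nat.
by rewrite gpC ray_gp// ler_nat.
Qed.

(** At time [t] both rays have product about [t] with far points of
themselves, and these far points have a large product with each other. *)
Lemma rays_close r r' : geodesic_ray r -> geodesic_ray r' ->
  eqv (ray_seq r) (ray_seq r') -> exists K, forall t, 0 <= t -> d (r t) (r' t) <= K.
Proof.
move=> rr rr' h; pose D := d (r 0) (r' 0).
exists (3 * D + 4 * delta) => t t0.
have [N hN] := h (r 0) t; pose n := maxn N (Num.truncn t).+1.
have tn : t <= n%:R.
  by apply: (le_trans (ltW (truncnS_gt t))); rewrite ler_nat leq_maxr.
have h1 := hN n n (leq_maxl _ _) (leq_maxl _ _).
have h2 := ray_gp rr t0 tn; have h3 := ray_gp rr' t0 tn.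
have h4 := gp_base (r' 0) (r 0) (r' t) (r' n%:R);
  rewrite h3 (metric_sym (r' 0)) in h4.
have D0 : 0 <= D by exact: mdist_ge0.
have h5 : t - D <= gp (r 0) (r t) (r n%:R) by rewrite h2; lra.
have h6 : t - D <= gp (r 0) (r' n%:R) (r n%:R) by rewrite gpC; move: h1;
  rewrite /ray_seq; lra.
have h7 := gp_ge four h5 h6.
have h8 : t - D - delta <= gp (r 0) (r' t) (r' n%:R).
  by rewrite -/D in h4; have := delta_ge0 four (r 0); lra.
have := gp_ge four h7 h8; rewrite /gromov_product rr// subr0 ger0_norm//.
have := metric_triangle (r' t) (r' 0) (r 0);
  rewrite rr'// subr0 ger0_norm// (metric_sym (r' 0)) -/D.
lra.
Qed.

Lemma close_rays_eqv r r' (K : R) : geodesic_ray r ->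
  (forall t, 0 <= t -> d (r t) (r' t) <= K) -> eqv (ray_seq r) (ray_seq r').
Proof.
move=> rr cl; apply/eqv_sym; apply: (@eqv_close (ray_seq r) _ _ K).
  by move=> n; exact: cl.
exact: ray_eqv.
Qed.

Local Notation im r := (r @` [set` `[0, +oo[]).

Lemma close_rays_hausdorff r r' (K : R) :
  (forall t, 0 <= t -> d (r t) (r' t) <= K) -> finite_hausdorff (im r) (im r').
Proof.
move=> cl; exists K; split=> _ [t /= t0 <-]; rewrite in_itv/= andbT in t0.
  by exists (r' t); [exists t; rewrite //= in_itv/= t0 | exact: cl].
by exists (r t); [exists t; rewrite //= in_itv/= t0 | exact: cl].
Qed.

(** A point of [r'] near [r t] has a parameter close to [t], both being about
the distance to the starting points. *)
Lemma hausdorff_rays_close r r' : geodesic_ray r -> geodesic_ray r' ->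
  finite_hausdorff (im r) (im r') -> exists K, forall t, 0 <= t -> d (r t) (r' t) <= K.
Proof.
move=> rr rr' [K [h _]]; exists (2 * K + d (r 0) (r' 0)) => t t0.
have [|_ [s /= s0 <-] rs] := h (r t); first by exists t;
  rewrite //= in_itv/= t0.
rewrite in_itv/= andbT in s0.
have h1 : `|s - t| <= K + d (r 0) (r' 0).
  have e1 : d (r t) (r 0) = t by rewrite rr// subr0 ger0_norm.
  have e2 : d (r' s) (r' 0) = s by rewrite rr'// subr0 ger0_norm.
  have := metric_triangle (r t) (r' s) (r 0);
    have := metric_triangle (r' s) (r' 0) (r 0).
  have := metric_triangle (r' s) (r t) (r' 0);
    have := metric_triangle (r t) (r 0) (r' 0).
  rewrite (metric_sym (r' s) (r t)) (metric_sym (r' 0) (r 0)) e1 e2.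
  by rewrite ler_norml => *; apply/andP; split; lra.
have := metric_triangle (r t) (r' s) (r' t); rewrite rr'//; lra.
Qed.

Lemma ray_classP r r' : geodesic_ray r ->
  ray_class r r' <-> geodesic_ray r' /\ eqv (ray_seq r) (ray_seq r').
Proof.
move=> rr; split=> -[rr' h]; split => //.
  by have [K hK] := hausdorff_rays_close rr rr' h; exact: close_rays_eqv hK.
by have [K hK] := rays_close rr rr' h; exact: close_rays_hausdorff hK.
Qed.

Lemma ray_class_eq r r' : geodesic_ray r -> geodesic_ray r' ->
  ray_class r = ray_class r' <-> eqv (ray_seq r) (ray_seq r').
Proof.
move=> rr rr'; split=> [e|h].
  have : ray_class r' r' by apply/ray_classP => //; split => //; exact: ray_eqv.
  by rewrite -e => /(ray_classP _ rr)[].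
apply/seteqP; split=> r'' /ray_classP[]// rr'' h'; apply/ray_classP => //;
  split => //.
  by apply: eqv_trans h'; exact: eqv_sym.
exact: eqv_trans h'.
Qed.

Section Isometry.
Variables f f' : X -> X.
Hypothesis fI : forall x y, d (f x) (f y) = d x y.
Hypothesis fK : cancel f f'.
Hypothesis f'K : cancel f' f.

Lemma ray_isometry (g : X -> X) r : (forall x y, d (g x) (g y) = d x y) ->
  geodesic_ray r -> geodesic_ray (g \o r).
Proof. by move=> gI rr s t s0 t0 /=; rewrite gI rr. Qed.

Lemma inv_isometry x y : d (f' x) (f' y) = d x y.
Proof. by rewrite -fI !f'K. Qed.

Lemma boundary_map_class r : geodesic_ray r ->
  boundary_map f (ray_class r) = ray_class (f \o r).
Proof.
move=> rr; have rfr := ray_isometry fI rr; apply/seteqP;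
  split=> [_ [r' /(ray_classP _ rr)[rr' h] <-]|r'].
  by apply/ray_classP => //; split;
    [exact: ray_isometry | exact: eqv_isometry fI h].
move=> /(ray_classP _ rfr)[rr' h]; exists (f' \o r');
  last by apply/funext => t /=; rewrite f'K.
apply/ray_classP => //; split; first exact: ray_isometry inv_isometry _.
have := eqv_isometry inv_isometry h.
by congr eqv; apply/funext => n /=; rewrite /ray_seq/= fK.
Qed.

Lemma iter_inv n : cancel (iter n f') (iter n f).
Proof. by elim: n => // n ih y; rewrite iterSr iterS f'K ih. Qed.

Variable x : X.
Let a n := d x (iter n f x).
Hypothesis aoo : forall M, exists N, forall n, (N <= n)%N -> M <= a n.

Lemma dist_iter_inv n : d x (iter n f' x) = a n.
Proof. by rewrite -(iter_isometry fI n) iter_inv metric_sym. Qed.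

Lemma unbounded_not_elliptic : ~ elliptic f.
Proof.
move=> [y [K h]]; have [N hN] := aoo (2 * d x y + K + 1).
have := hN N (leqnn _); have := h N.
have := metric_triangle x y (iter N f x).
have := metric_triangle y (iter N f y) (iter N f x).
by rewrite (iter_isometry fI) (metric_sym y x) /a; lra.
Qed.

Variable K : R.
(** The conclusion of [orbit_quasigeodesic]. *)
Hypothesis aK : forall m n, a m + a n <= a (m + n) + K.

Lemma orbit_gp i j : (i <= j)%N -> a i - K / 2 <= gp x (iter i f x) (iter j f x).
Proof.
move=> ij; have := aK i (j - i); rewrite subnKC//.
rewrite /gromov_product -{4}(subnKC ij) (iter_dist fI).
by rewrite !(metric_sym _ x) -!/(a _); lra.
Qed.

Lemma orbit_eqv : eqv (fun n => iter n f x) (fun n => iter n f x).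
Proof.
apply: (@equivalent_from_base x) => M; have [N hN] := aoo (M + K / 2);
  exists N => i j iN jN.
have [ij|/ltnW ji] := leqP i j.
  by have := orbit_gp ij; have := hN i iN; lra.
by rewrite gpC; have := orbit_gp ji; have := hN j jN; lra.
Qed.

(** Seen from [x], the forward and the backward orbit go in opposite
directions. *)
Lemma orbit_gp_inv m n : gp x (iter m f x) (iter n f' x) <= K / 2.
Proof.
rewrite /gromov_product !(metric_sym _ x) dist_iter_inv -/(a m).
have -> : d (iter m f x) (iter n f' x) = a (n + m).
  by rewrite -(iter_isometry fI n) iter_inv -iterD metric_sym.
by have := aK n m; lra.
Qed.

Lemma orbit_not_eqv_inv : ~ eqv (fun n => iter n f x) (fun n => iter n f' x).
Proof.
move=> h; have [N hN] := h x (K / 2 + 1).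
by have := hN N N (leqnn _) (leqnn _); have := orbit_gp_inv N N; lra.
Qed.

Lemma orbit_converges r : geodesic_ray r -> eqv (ray_seq r) (fun n => iter n f x) ->
  forall y, converges_to_boundary (fun n => iter n f y) (ray_class r).
Proof.
move=> rr h y.
have cl n : d (iter n f x) (iter n f y) <= d x y by rewrite (iter_isometry fI).
have hy v : eqv (fun n => iter n f x) v -> eqv (fun n => iter n f y) v.
  exact: eqv_close cl.
split; first by exists r.
- by apply: (hy); apply: eqv_sym; apply: (hy); exact: orbit_eqv.
- move=> r' /(ray_classP _ rr)[rr' h'].
  apply: hy; apply: eqv_trans h'; exact: eqv_sym.
Qed.

Lemma orbit_limit_fixed r : geodesic_ray r -> eqv (ray_seq r) (fun n => iter n f x) ->
  boundary_map f (ray_class r) = ray_class r.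
Proof.
move=> rr h; rewrite boundary_map_class//; apply/ray_class_eq => //;
  first exact: ray_isometry.
apply: (eqv_trans (eqv_isometry fI h)); apply: eqv_trans (eqv_sym h).
exact: (eqv_shift orbit_eqv).
Qed.

(** Suppose that [r] tends neither to the forward nor to the backward limit, so
that its products with both half-orbits, based at [x], are bounded. Take a
point [y] far on [r]. Its product with [x] based at [f^n x] is then about
[a n]. Applying [f^n] to the products with the backward orbit shows that the
product of [f^n y] with [x] based at [f^n x] is bounded. But [f^n y] stays at a
distance from [y] depending only on [n], so the two products agree up to
[delta], which is absurd for large [n]. *)
Lemma fixed_ray r : geodesic_ray r -> boundary_map f (ray_class r) = ray_class r ->
  eqv (fun n => iter n f' x) (fun n => iter n f' x) ->
  eqv (ray_seq r) (fun n => iter n f x) \/ eqv (ray_seq r) (fun n => iter n f' x).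
Proof.
move=> rr fixr inveqv; apply: contrapT => /not_orP[n1 n2].
have [B1 hB1] := not_eqv_bounded x (ray_eqv rr) orbit_eqv n1.
have [B2 hB2] := not_eqv_bounded x (ray_eqv rr) inveqv n2.
have rfr := ray_isometry fI rr.
have [D hD] : exists D, forall t, 0 <= t -> d ((f \o r) t) (r t) <= D.
  by apply: rays_close => //; apply/ray_class_eq;
    rewrite // -boundary_map_class.
have hDn n t : 0 <= t -> d (iter n f (r t)) (r t) <= n%:R * D.
  move=> t0; elim: n => [|n ih]; first by rewrite mdistxx mul0r.
  have := metric_triangle (iter n f (f (r t))) (iter n f (r t)) (r t).
  rewrite (iter_isometry fI n (f (r t))) -iterSr; have := hD t t0 => /=.
  by rewrite -[n.+1]addn1 natrD; lra.
have [n hn] := aoo (B1 + B2 + delta + 1); have {hn}an := hn n (leqnn _).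
pose t := (Num.truncn (B2 + delta + n%:R * D + a n + d (r 0) x)).+1.
have tge : B2 + delta + n%:R * D + a n + d (r 0) x < t%:R by exact: truncnS_gt.
pose y := r t%:R; pose xn := iter n f x.
have e1 : gp xn (iter n f y) x <= B2.
  have := hB2 t n; rewrite -(gp_isometry _ _ _ (iter_isometry fI n)) iter_inv.
  exact.
have yx : t%:R - d (r 0) x <= d y x.
  have := metric_triangle (r t%:R) x (r 0);
    rewrite rr// subr0 ger0_norm// (metric_sym x); rewrite -/y; lra.
have e2 : a n - B1 <= gp xn y x.
  have := hB1 t n; rewrite /gromov_product -/xn /ray_seq -/y.
  by rewrite (metric_sym xn x) -/(a n); lra.
have e3 : a n - B1 <= gp xn x y by rewrite gpC.
have e4 : B2 + delta < gp xn (iter n f y) y.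
  rewrite /gromov_product (iter_isometry fI n y x).
  have := hDn n t%:R (ler0n _ _); rewrite -/y.
  have := metric_triangle y xn x; rewrite (metric_sym xn x) -/(a n).
  have := mdist_ge0 (iter n f y) y; have : 0 <= a n by exact: mdist_ge0.
  lra.
have e5 : Num.min (a n - B1) (gp xn (iter n f y) y) <= gp xn (iter n f y) y.
  by rewrite ge_min lexx orbT.
have e6 : Num.min (a n - B1) (gp xn (iter n f y) y) <= gp xn x y.
  by rewrite ge_min e3.
have := gp_ge four e5 e6; rewrite /Num.min; case: ifP => _; lra.
Qed.

End Isometry.

Lemma attracting_orbit (f f' : X -> X) x (K : R) rp rm :
  (forall x y, d (f x) (f y) = d x y) -> cancel f f' -> cancel f' f ->
  (forall M, exists N, forall n, (N <= n)%N -> M <= d x (iter n f x)) ->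
  (forall m n, d x (iter m f x) + d x (iter n f x) <= d x (iter (m + n) f x) + K) ->
  geodesic_ray rp -> eqv (ray_seq rp) (fun n => iter n f x) ->
  geodesic_ray rm -> eqv (ray_seq rm) (fun n => iter n f' x) ->
  attracting_point f (ray_class rp).
Proof.
move=> fI fK f'K aoo aK rrp hrp rrm hrm.
have f'I := inv_isometry fI f'K.
have aoo' M : exists N, forall n, (N <= n)%N -> M <= d x (iter n f' x).
  by have [N hN] := aoo M; exists N => n; rewrite (dist_iter_inv fI f'K);
    exact: hN.
have aK' m n : d x (iter m f' x) + d x (iter n f' x) <= d x (iter (m + n) f' x) + K.
  by rewrite !(dist_iter_inv fI f'K).
have inveqv := orbit_eqv f'I aoo' aK'.
split; last exact: (orbit_converges fI aoo aK).
split; first exact: (unbounded_not_elliptic fI aoo).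
exists (ray_class rp), (ray_class rm); split.
  move/ray_class_eq => /(_ rrp rrm) h; apply: (orbit_not_eqv_inv fI f'K aK).
  by apply: eqv_trans hrm; apply: eqv_trans h; exact: eqv_sym.
apply/seteqP; split=> [_ [[r rr <-] fixr]|om].
  have [h|h] := fixed_ray fI fK f'K aoo aK rr fixr inveqv; [left|right].
    by apply/ray_class_eq => //; apply: (eqv_trans h); exact: eqv_sym.
  by apply/ray_class_eq => //; apply: (eqv_trans h); exact: eqv_sym.
move=> [->|->]; first by split;
  [exists rp | exact: (orbit_limit_fixed fI fK f'K aoo aK)].
split; first by exists rm.
have e := orbit_limit_fixed f'I f'K fK aoo' aK' rrm hrm.
rewrite -{1}e /boundary_map; apply/seteqP; split=> [_ [_ [r h <-] <-]|r h].
  by rewrite (_ : _ \o _ = r)//; apply/funext => t /=; rewrite f'K.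
exists (f' \o r); first by exists r.
by apply/funext => t /=; rewrite f'K.
Qed.

End Boundary.

(** * Isometries fixing two points, and orbits with a common end *)

Section Fellow.
Variables (R : realType) (X : metricType R) (delta : R).
Implicit Types (x y z p : X) (u v w : nat -> X) (r : R -> X).
Notation d := (@mdist R X).
Notation gp := (@gromov_product R X).
Notation eqv := (@equivalent_at_infinity R X).
Hypothesis four : forall x y z p, gp p x y >= Num.min (gp p x z) (gp p y z) - delta.

(** The point [x] is close to a geodesic from [p] to [q], and an isometry
fixing both ends almost fixes the points of such a geodesic. *)
Lemma fix_two_close (g : X -> X) p q x (B : R) : (forall x y, d (g x) (g y) = d x y) ->
  g p = p -> g q = q -> gp x p q <= B -> d (g x) x <= 2 * B + 2 * delta.
Proof.
move=> gI gp' gq; rewrite /gromov_product => hB.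
have e1 : d p (g x) = d p x by rewrite -{1}gp' gI.
have e2 : d q (g x) = d q x by rewrite -{1}gq gI.
have := four_dist four p q x (g x); rewrite (metric_sym x (g x)) e1 e2.
by case; lra.
Qed.

(** The properties of an orbit established for elements moving towards
infinity. *)
Definition quasi_axis (x : X) (f : X -> X) (K : R) :=
  [/\ forall x y, d (f x) (f y) = d x y,
      forall M, exists N, forall n, (N <= n)%N -> M <= d x (iter n f x) &
      forall m n, d x (iter m f x) + d x (iter n f x) <= d x (iter (m + n) f x) + K].

(** The two orbits [f^n x] and [g (f^n x)] start at the same point, have the
same limit, and are at the same distance from [x] for each [n]. *)
Lemma fix_limit_close (f g : X -> X) x (K : R) : quasi_axis x f K ->
  (forall x y, d (g x) (g y) = d x y) -> g x = x ->
  eqv (fun n => g (iter n f x)) (fun n => iter n f x) ->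
  forall n, d (g (iter n f x)) (iter n f x) <= K + 4 * delta.
Proof.
move=> [fI aoo aK] gI gx h n.
have [N hN] := h x (d x (iter n f x)); pose i := maxn N n.
have K0 : 0 <= K by have := aK 0%N 0%N; rewrite /= mdistxx; lra.
have d0 := delta_ge0 four x.
have h1 := orbit_gp fI aK (leq_maxr N n : (n <= i)%N).
have h2 : d x (iter n f x) - K / 2 <= gp x (g (iter n f x)) (g (iter i f x)).
  have e : gp (g x) (g (iter n f x)) (g (iter i f x)) = gp x (iter n f x) (iter i f x).
    exact: gp_isometry.
  by rewrite gx in e; rewrite e.
have h3 : d x (iter n f x) - K / 2 <= gp x (iter i f x) (g (iter i f x)).
  by rewrite gpC; have := hN i i (leq_maxl _ _) (leq_maxl _ _); lra.
have h4 := gp_ge four h2 h3.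
have h5 : d x (iter n f x) - K / 2 - delta <= gp x (iter n f x) (iter i f x) by lra.
have := gp_ge four h4 h5; rewrite /gromov_product.
have -> : d (g (iter n f x)) x = d x (iter n f x).
  by rewrite (metric_sym x) -[in RHS](gI _ x) gx.
by rewrite (metric_sym _ x); lra.
Qed.

(** Given [n], choose [m] with [d x (g^m x)] just above [d x (f^n x)]; points of
two orbits with a common limit and at the same distance from [x] are close. *)
Lemma orbits_fellow (f g : X -> X) x (K L : R) : quasi_axis x f K -> quasi_axis x g L ->
  eqv (fun n => iter n f x) (fun n => iter n g x) ->
  exists C, forall n, exists m, d (iter n f x) (iter m g x) <= C.
Proof.
move=> [fI aoo aK] [gI boo bL] h.
have K0 : 0 <= K by have := aK 0%N 0%N; rewrite /= mdistxx; lra.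
have L0 : 0 <= L by have := bL 0%N 0%N; rewrite /= mdistxx; lra.
have d0 := delta_ge0 four x.
exists (d x (g x) + K + L + 4 * delta) => n.
have [m hm1 hm2] : exists2 m, d x (iter n f x) <= d x (iter m g x) &
    d x (iter m g x) <= d x (iter n f x) + d x (g x).
  have [N hN] := boo (d x (iter n f x)).
  have exN : exists m, d x (iter n f x) <= d x (iter m g x) by exists N;
    exact: hN.
  case: (ex_minnP exN) => -[|m] hm minm; exists m.+1 || exists 0%N => //.
    by rewrite /= mdistxx addr_ge0 ?mdist_ge0.
  have : d x (iter m g x) < d x (iter n f x).
    by rewrite ltNge; apply/negP => /minm; rewrite ltnn.
  have := metric_triangle x (iter m g x) (iter m.+1 g x).
  by rewrite -{2}addn1 (iter_dist gI) /=; lra.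
exists m.
have [N hN] := h x (d x (iter n f x)).
pose i := maxn N (maxn n m).
have iN : (N <= i)%N by exact: leq_maxl.
have ni : (n <= i)%N by rewrite leq_max leq_maxl orbT.
have mi : (m <= i)%N by rewrite leq_max leq_maxr orbT.
have h1 := orbit_gp fI aK ni; have h2 := orbit_gp gI bL mi;
  have h3 := hN i i iN iN.
pose M := d x (iter n f x) - K / 2 - L / 2.
have h1' : M <= gp x (iter n f x) (iter i f x) by rewrite /M; lra.
have h3' : M <= gp x (iter i g x) (iter i f x) by rewrite /M gpC; lra.
have h4 := gp_ge four h1' h3'.
have h2' : M - delta <= gp x (iter m g x) (iter i g x) by rewrite /M; lra.
have := gp_ge four h4 h2'; rewrite /gromov_product /M !(metric_sym _ x); lra.
Qed.

End Fellow.

(** * Graph distance, geodesic rays and the action on the realization *)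

Section GraphDist.
Variable Gamma : connected_graph.
Implicit Types (u v w : Gamma).

Definition has_path u v : pred nat :=
  fun n => `[< exists p, [/\ path (@adj Gamma) u p, last u p = v & size p = n] >].

Lemma has_path_ex u v : exists n, has_path u v n.
Proof.
have [p up pv] := cgraph_connected u v; exists (size p).
by apply/asboolP; exists p.
Qed.

(** The distance in the graph, as a natural number; [mdist_vert] compares it with
the path metric. *)
Definition gd u v : nat := ex_minn (has_path_ex u v).

Lemma gd_path u v : exists p, [/\ path (@adj Gamma) u p, last u p = v & size p = gd u v].
Proof. by rewrite /gd; case: ex_minnP => n /asboolP. Qed.

Lemma gd_le u p : path (@adj Gamma) u p -> (gd u (last u p) <= size p)%N.
Proof.
by move=> up; rewrite /gd; case: ex_minnP => n _; apply; apply/asboolP;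
  exists p.
Qed.

Lemma gdxx u : gd u u = 0%N.
Proof. by apply/eqP; rewrite -leqn0; exact: (@gd_le u [::]). Qed.

Lemma gd_adj u v : adj u v -> (gd u v <= 1)%N.
Proof. by move=> uv; apply: (@gd_le u [:: v]); rewrite /= uv. Qed.

Lemma gd_eq0 u v : gd u v = 0%N -> u = v.
Proof. by have [p [_ <- <-]] := gd_path u v => /size0nil ->. Qed.

Lemma gd_triangle v u w : (gd u w <= gd u v + gd v w)%N.
Proof.
have [p [up pv sp]] := gd_path u v; have [q [vq qw sq]] := gd_path v w.
rewrite -sp -sq -size_cat -qw -{1}pv -last_cat; apply: gd_le.
by rewrite cat_path up pv vq.
Qed.

Lemma gd_sym u v : gd u v = gd v u.
Proof.
suff h x y : (gd x y <= gd y x)%N by apply/eqP; rewrite eqn_leq !h.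
have [p [yp px <-]] := gd_path y x.
have := @gd_le x (rev (belast y p)); rewrite size_rev size_belast.
have -> : last x (rev (belast y p)) = y.
  by case: p yp px => [|z p] //= _ _; rewrite rev_cons last_rcons.
apply; rewrite -px rev_path -(eq_path (e := @adj Gamma))// => z t.
by rewrite adj_sym.
Qed.

Lemma gd_next u v : (0 < gd u v)%N -> exists w, adj u w /\ gd u v = (gd w v).+1.
Proof.
have [p [up pv sp]] := gd_path u v; case: p up pv sp => [|w p] /=;
  first by move=> _ _ <-.
move=> /andP[uw wp] pv sp _; exists w; split => //.
apply/eqP; rewrite eqn_leq; apply/andP; split.
  by apply: leq_trans (gd_triangle w u v) _;
    rewrite -addn1 addnC leq_add2l gd_adj.
by rewrite -sp -pv ltnS; exact: gd_le.
Qed.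

Hypothesis lf : locally_finite Gamma.

Lemma finite_ball v n : finite_set [set w | (gd v w <= n)%N].
Proof.
elim: n => [|n ih].
  by apply: sub_finite_set (finite_set1 v) => w /=;
    rewrite leqn0 => /eqP/gd_eq0 ->.
have : finite_set (\bigcup_(u in [set w | (gd v w <= n)%N]) (u |` [set w | adj u w])).
  by apply: bigcup_finite => // u _; rewrite finite_setU; split;
    [exact: finite_set1 | exact: lf].
apply: sub_finite_set => w /= vw.
have [wn|nw] := leqP (gd v w) n; first by exists w => //; left.
have : (0 < gd w v)%N by rewrite gd_sym; exact: leq_trans nw.
move=> /gd_next[u [wu e]]; exists u; last by right; rewrite /= adj_sym.
by rewrite /= gd_sym -ltnS -e gd_sym.
Qed.

End GraphDist.

Section Vertices.
Variables (R : realType) (Gamma : connected_graph).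
Implicit Types (u v w : Gamma).
Notation X := (realization R Gamma).

Lemma edge_point0 u v : edge_point (R := R) u v 0 = edge_point u u 0.
Proof. by apply/funext => w; rewrite /edge_point !mul0r. Qed.

Lemma edge_point1 u v : edge_point (R := R) u v 1 = edge_point v v 0.
Proof. by rewrite edge_pointC subrr edge_point0. Qed.

Lemma seg_is_point u v (t : R) : adj u v -> 0 <= t <= 1 -> is_point (edge_point u v t).
Proof. by move=> uv t01; exists u, v; split; [left | exists t]. Qed.

Lemma vert_is_point v : is_point (edge_point (R := R) v v 0).
Proof. by exists v, v; split; [right | exists 0; rewrite ?lexx ?ler01]. Qed.

Definition vert v : X := exist _ _ (vert_is_point v).

Lemma polyline_path u p : path (@adj Gamma) u p ->
  polyline (edge_point u u 0) (edge_point (last u p) (last u p) 0) ((size p)%:R : R).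
Proof.
elim: p u => [|a p ih] u /=; first by move=> _; exact: polyline_nil.
move=> /andP[ua /ih h]; rewrite -[(size p).+1]add1n natrD.
have -> : 1%:R = `|edge_point (R := R) u u 0 u - edge_point a a 0 u|.
  have /negPf h' : u != a by apply: contraTneq ua => ->; rewrite adj_irr.
  by rewrite /edge_point eqxx h' !(mul0r, mulr0, addr0, subr0, mulr1) normr1.
apply: (polyline_cons ua) h.
  by rewrite -(edge_point0 u a); exists 0; rewrite ?lexx ?ler01.
by rewrite -(edge_point1 u a); exists 1; rewrite ?lexx ?ler01.
Qed.

(** The lower bound on the length of polygonal paths. A vertex [p] with
[x p > 0] is an end of any edge containing [x], at distance [1 - x p], so the
bound can be followed from edge to edge. *)
Lemma polyline_gd (x y : Gamma -> R) l w : polyline x y l -> y = edge_point w w 0 ->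
  forall p, 0 < x p -> (gd p w)%:R <= l + 1 - x p.
Proof.
have vals (u v : Gamma) (x' : Gamma -> R) : adj u v -> on_edge u v x' ->
    [/\ 0 <= x' u <= 1, x' v = 1 - x' u & forall p, 0 < x' p -> p = u \/ p = v].
  move=> uv [t t01 ->]; have nuv : u != v by apply: contraTneq uv => ->;
    rewrite adj_irr.
  have e1 : edge_point u v t u = 1 - t by rewrite edge_pointl.
  have e2 : edge_point u v t v = t.
    by rewrite /edge_point eqxx eq_sym (negPf nuv) mulr0 add0r mulr1.
  split; [by rewrite e1; lra | by rewrite e1 e2; lra |].
  move=> p; rewrite /edge_point; case: eqVneq => [->|_]; first by left.
  by case: eqVneq => [->|_]; [right | rewrite !mulr0 addr0 ltxx].
elim=> {x y l} [x|u v x y z l uv xe ye _ ih].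
  move=> -> p; rewrite /edge_point mul0r addr0 subr0 mul1r.
  by case: eqVneq => [->|]; rewrite ?ltxx//= gdxx mulr1n => _; lra.
move=> zw; have {}ih := ih zw.
have [xu xv xp] := vals _ _ _ uv xe; have [yu yv yp] := vals _ _ _ uv ye.
have h1 : (gd u w)%:R <= 1 + (gd v w)%:R :> R.
  by rewrite nat1r ler_nat (leq_trans (gd_triangle v u w))// -add1n leq_add2r gd_adj.
have h2 : (gd v w)%:R <= 1 + (gd u w)%:R :> R.
  by rewrite nat1r ler_nat (leq_trans (gd_triangle u v w))// -add1n leq_add2r gd_adj// adj_sym.
have yl : (gd u w)%:R <= l + 1 - y u /\ (gd v w)%:R <= l + 1 - y v.
  have [yu0|yu0] := ltP 0 (y u).
    split; first exact: ih.
    have [yv0|yv0] := ltP 0 (y v); first exact: ih.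
    by have := ih _ yu0; lra.
  have yv0 : 0 < y v by lra.
  by split; [have := ih _ yv0; lra | exact: ih].
have := ler_norm (x u - y u); have := ler_norm (y u - x u);
  rewrite (distrC (y u)) => n1 n2.
by move=> p /xp[->|->]; lra.
Qed.

Lemma mdistE (x y : X) : mdist x y = path_dist (sval x) (sval y).
Proof. by []. Qed.

Lemma mdist_vert u v : mdist (vert u) (vert v) = (gd u v)%:R.
Proof.
apply/eqP; rewrite eq_le; apply/andP; split.
  have [p [up pv <-]] := gd_path u v; rewrite mdistE -pv.
  exact: path_dist_le (polyline_path up).
rewrite mdistE; apply: lb_le_inf; first exact: polyline_exists.
move=> l /= /polyline_gd => /(_ v erefl u).
have -> : edge_point u u 0 u = 1 :> R.
  by rewrite /edge_point eqxx mul0r addr0 subr0 mulr1.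
by rewrite ltr01 => /(_ isT); lra.
Qed.

Lemma mdist_edge u v (s t : R) (uv : adj u v) (hs : 0 <= s <= 1) (ht : 0 <= t <= 1) :
  mdist (exist _ _ (seg_is_point uv hs) : X) (exist _ _ (seg_is_point uv ht)) <= `|s - t|.
Proof.
rewrite mdistE /=; apply: path_dist_le.
have -> : `|s - t| = `|edge_point u v s u - edge_point u v t u| + 0.
  by rewrite !edge_pointl// addr0 distrC; congr `|_|; ring.
by apply: (polyline_cons uv _ _ (polyline_nil _)); [exists s | exists t].
Qed.

Section RayOfVertices.
Variable rho : nat -> Gamma.
Hypothesis rho_gd : forall i j, (i <= j)%N -> gd (rho i) (rho j) = (j - i)%N.

Lemma rho_adj n : adj (rho n) (rho n.+1).
Proof.
have h := rho_gd (leqnSn n); rewrite subSnn in h.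
have [|w [aw e]] := @gd_next _ (rho n) (rho n.+1); first by rewrite h.
by rewrite h in e; case: e => /esym/gd_eq0 <-.
Qed.

Lemma frac_itv (t : R) : 0 <= `|t| - (Num.truncn `|t|)%:R <= 1.
Proof.
have := truncn_itv (normr_ge0 t) => /andP[h1 h2].
by rewrite -natr1 in h2; apply/andP; split; lra.
Qed.

(** The absolute value makes this a point of the realization for negative [t]
as well; a geodesic ray is only constrained on nonnegative times. *)
Definition vertex_ray (t : R) : X :=
  exist _ _ (seg_is_point (rho_adj (Num.truncn `|t|)) (frac_itv t)).

Lemma eq_point (x y : X) : sval x = sval y -> x = y.
Proof. by case: x y => x px [y py] /= e; exact: eq_exist. Qed.

Lemma vertex_ray_nat n : vertex_ray n%:R = vert (rho n).
Proof. by apply: eq_point; rewrite /= normr_nat natrK subrr edge_point0. Qed.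

Lemma vertex_rayl (t : R) n : 0 <= t -> Num.truncn t = n ->
  mdist (vert (rho n)) (vertex_ray t) <= t - n%:R.
Proof.
move=> t0 tn; have h0 : 0 <= (0 : R) <= 1 by rewrite lexx ler01.
have -> : vert (rho n) = exist _ _ (seg_is_point (rho_adj (Num.truncn `|t|)) h0) :> X.
  by apply: eq_point; rewrite /= edge_point0 ger0_norm// tn.
apply: le_trans (mdist_edge _ _ _) _.
by rewrite distrC subr0 !ger0_norm ?tn//; have /andP[] := frac_itv t;
  rewrite ger0_norm// tn.
Qed.

Lemma vertex_rayr (t : R) n : 0 <= t -> Num.truncn t = n ->
  mdist (vertex_ray t) (vert (rho n.+1)) <= n%:R + 1 - t.
Proof.
move=> t0 tn; have h0 : 0 <= (1 : R) <= 1 by rewrite lexx ler01.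
have -> : vert (rho n.+1) = exist _ _ (seg_is_point (rho_adj (Num.truncn `|t|)) h0) :> X.
  by apply: eq_point; rewrite /= edge_point1 ger0_norm// tn.
apply: le_trans (mdist_edge _ _ _) _.
have /andP[] := frac_itv t; rewrite ger0_norm// tn => h1 h2.
by rewrite ler0_norm; lra.
Qed.

Lemma vertex_ray_geodesic : geodesic_ray vertex_ray.
Proof.
suff h s t : 0 <= s -> s <= t -> mdist (vertex_ray s) (vertex_ray t) = t - s.
  move=> s t s0 t0; have [st|/ltW ts] := leP s t.
    by rewrite h// distrC ger0_norm// subr_ge0.
  by rewrite metric_sym h// ger0_norm// subr_ge0.
move=> s0 st; have t0 := le_trans s0 st.
pose n := Num.truncn s; pose m := Num.truncn t.
have nm : (n <= m)%N by exact: le_truncn.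
have ls := vertex_rayl s0 (erefl n); have lt := vertex_rayl t0 (erefl m).
have rs := vertex_rayr s0 (erefl n); have rt := vertex_rayr t0 (erefl m).
have D i j : (i <= j)%N -> mdist (vert (rho i)) (vert (rho j)) = j%:R - i%:R.
  by move=> ij; rewrite mdist_vert rho_gd// natrB.
apply/eqP; rewrite eq_le; apply/andP; split; last first.
  have := metric_triangle (vert (rho 0)) (vert (rho n)) (vertex_ray s).
  have := metric_triangle (vert (rho 0)) (vertex_ray s) (vertex_ray t).
  have := metric_triangle (vert (rho 0)) (vertex_ray t) (vert (rho m.+1)).
  by rewrite !D// -natr1; lra.
have [nm'|] := ltnP n m.
  have := metric_triangle (vertex_ray s) (vert (rho n.+1)) (vertex_ray t).
  have := metric_triangle (vert (rho n.+1)) (vert (rho m)) (vertex_ray t).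
  by rewrite D// -natr1; lra.
move=> mn; have e : m = n by apply/eqP; rewrite eqn_leq mn.
have es : Num.truncn `|s| = n by rewrite ger0_norm.
have et : Num.truncn `|t| = n by rewrite ger0_norm.
have hs : 0 <= s - n%:R <= 1 by have := frac_itv s; rewrite ger0_norm.
have ht : 0 <= t - n%:R <= 1 by have := frac_itv t; rewrite ger0_norm// -/m e.
have -> : vertex_ray s = exist _ _ (seg_is_point (rho_adj n) hs).
  by apply: eq_point; rewrite /= es ger0_norm.
have -> : vertex_ray t = exist _ _ (seg_is_point (rho_adj n) ht).
  by apply: eq_point; rewrite /= et ger0_norm.
apply: le_trans (mdist_edge _ _ _) _.
by rewrite ler0_norm; lra.
Qed.

End RayOfVertices.

Section Konig.
Variable delta : R.
Hypothesis four : forall x y z p : X,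
  gromov_product p x y >= Num.min (gromov_product p x z) (gromov_product p y z) - delta.
Hypothesis lf : locally_finite Gamma.
Variable xs : nat -> Gamma.
Hypothesis xs_eqv : equivalent_at_infinity (vert \o xs) (vert \o xs).
Variable v : Gamma.

(** Vertices on geodesics from [v] to infinitely many terms of the sequence. *)
Let toward w := forall N, exists2 n, (N <= n)%N & gd v (xs n) = (gd v w + gd w (xs n))%N.

Lemma xs_unbounded k : exists N, forall n, (N <= n)%N -> (k < gd v (xs n))%N.
Proof.
have [N hN] := xs_eqv (vert v) (k%:R + 1); exists N => n Nn.
have := hN n n Nn Nn => /le_trans/(_ (gp_le _ _ _)).
by rewrite /= mdist_vert gd_sym natr1 ler_nat.
Qed.

Lemma toward_next w : toward w -> exists w', [/\ adj w w', gd v w' = (gd v w).+1 & toward w'].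
Proof.
move=> tw; apply: contrapT => /forallNP noW.
have /finite_seqP[s sE] := lf w.
have [n hn] : exists n, forall w', w' \in s -> forall m, (n <= m)%N ->
    gd v w' = (gd v w).+1 -> gd v (xs m) <> (gd v w' + gd w' (xs m))%N.
  apply: finite_uniform => w' w's; have := noW w'.
  have aw : adj w w' by have : [set w' | adj w w'] w' by rewrite sE.
  have [e|ne _] := eqVneq (gd v w') (gd v w).+1; last first.
    by exists 0%N => m _ /eqP; rewrite (negPf ne).
  move=> h; have {}h : ~ toward w' by move=> t; apply: h.
  have /existsNP[N hN] := h; exists N => m Nm _ e'; apply: hN; by exists m.
have [N hN] := xs_unbounded (gd v w).
have [m] := tw (maxn n N); rewrite geq_max => /andP[nm Nm] e.
have [|w' [aw e']] := @gd_next _ w (xs m).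
  by have := hN m Nm; rewrite e; lia.
have w's : w' \in s by have : [set w' | adj w w'] w' by []; rewrite sE.
have h1 := gd_triangle w v w'; have h2 := gd_triangle w' v (xs m);
  have h3 := gd_adj aw.
by apply: (hn w' w's m nm); lia.
Qed.

(** König's lemma: starting at [v], choose successively vertices on geodesics to
infinitely many [xs n]. *)
Lemma geodesic_to_limit : exists rho : nat -> Gamma,
  (forall i j, (i <= j)%N -> gd (rho i) (rho j) = (j - i)%N) /\
  equivalent_at_infinity (vert \o rho) (vert \o xs).
Proof.
have t0 : toward v by move=> N; exists N => //; rewrite gdxx.
have [next nextP] : {next : Gamma -> Gamma & forall w, toward w ->
    [/\ adj w (next w), gd v (next w) = (gd v w).+1 & toward (next w)]}.
  apply: (@choice _ _ (fun w w' => toward w ->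
    [/\ adj w w', gd v w' = (gd v w).+1 & toward w'])) => w.
  by have [/toward_next[w' h]|nt] := pselect (toward w); [exists w' | exists w].
pose rho n := iter n next v.
have rhoP n : toward (rho n) /\ gd v (rho n) = n.
  elim: n => [|n [ih1 ih2]]; first by rewrite /rho /= gdxx.
  by have [_ h2 h3] := nextP _ ih1; rewrite /rho iterS -/(rho n) h2 ih2.
exists rho; split.
  move=> i j ij; apply/eqP; rewrite eqn_leq; apply/andP; split.
    rewrite -{1}(subnKC ij); elim: (j - i)%N => [|k ih];
      first by rewrite addn0 gdxx.
    have h1 := gd_triangle (rho (i + k)%N) (rho i) (rho (i + k.+1)%N).
    have [/gd_adj + _ _] := nextP _ (rhoP (i + k)%N).1.
    have <- : rho (i + k.+1)%N = next (rho (i + k)%N) by rewrite addnS.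
    by move: h1 ih; lia.
  by have := gd_triangle (rho i) v (rho j); rewrite !(rhoP _).2; lia.
apply: (@equivalent_from_base _ _ (vert v)) => M.
have [N hN] := xs_eqv (vert v) (M + delta).
exists (maxn N (Num.truncn (M + delta)).+1) => i j;
  rewrite !geq_max => /andP[iN iM] /andP[jN _].
have [n Nn e] := (rhoP i).1 N; have h1 := hN j n jN Nn.
have h2 : M + delta <= gromov_product (vert v) (vert (rho i)) (vert (xs n)).
  rewrite /gromov_product !mdist_vert ![gd _ v]gd_sym e (rhoP i).2 natrD.
  have : M + delta <= i%:R by apply: (le_trans (ltW (truncnS_gt _)));
    rewrite ler_nat.
  by lra.
by have := gp_ge four h2 h1; rewrite /=; lra.
Qed.

Lemma ray_to_limit : exists2 r : R -> X, geodesic_ray r &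
  equivalent_at_infinity (ray_seq r) (vert \o xs).
Proof.
have [rho [hr he]] := geodesic_to_limit; exists (vertex_ray hr).
  exact: vertex_ray_geodesic.
by congr equivalent_at_infinity: he; apply/funext => n;
  rewrite /ray_seq vertex_ray_nat.
Qed.

End Konig.

End Vertices.

Section Action.
Variables (R : realType) (G : groupType) (Gamma : connected_graph).
Variable a : graph_action G Gamma.
Implicit Types (g h : G) (v : Gamma).
Notation act := (@point_action R G Gamma a).

Lemma on_edge_act g u v (x : Gamma -> R) : on_edge u v x ->
  on_edge (a g u) (a g v) (x \o a g^-1%g).
Proof.
move=> [t t01 ->]; exists t => //; apply/funext => w /=.
suff e z : (a g^-1%g w == z) = (w == a g z) by rewrite /edge_point !e.
by apply/eqP/eqP => [<-|->]; rewrite -gactM ?mulgV ?mulVg gact1.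
Qed.

Lemma gactK g : cancel (a g) (a g^-1%g).
Proof. by move=> v; rewrite -gactM mulVg gact1. Qed.

Lemma polyline_act g (x y : Gamma -> R) l : polyline x y l ->
  polyline (x \o a g^-1%g) (y \o a g^-1%g) l.
Proof.
elim=> {x y l} [x|u v x y z l uv xe ye _ ih]; first exact: polyline_nil.
have -> : `|x u - y u| = `|(x \o a g^-1%g) (a g u) - (y \o a g^-1%g) (a g u)| by rewrite /= gactK.
by apply: (polyline_cons _ (on_edge_act g xe) (on_edge_act g ye) ih);
  rewrite gact_adj.
Qed.

Lemma actM g h x : act (g * h)%g x = act g (act h x).
Proof.
apply: eq_point => /=; apply/funext => w /=.
by rewrite invgM gactM.
Qed.

Lemma act1 x : act 1%g x = x.
Proof. by apply: eq_point => /=; apply/funext => w /=; rewrite invg1 gact1. Qed.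

Lemma actK g : cancel (act g) (act g^-1%g).
Proof. by move=> x; rewrite -actM mulVg act1. Qed.

Lemma actVK g : cancel (act g^-1%g) (act g).
Proof. by move=> x; rewrite -actM mulgV act1. Qed.

Lemma act_isometry g x y : mdist (act g x) (act g y) = mdist x y.
Proof.
have h k z t : mdist (act k z) (act k t) <= mdist z t.
  rewrite !mdistE; apply: lb_le_inf; first exact: polyline_exists.
  by move=> l /(polyline_act k) h; exact: path_dist_le.
by apply/eqP; rewrite eq_le h/= -{1}(actK g x) -{1}(actK g y) h.
Qed.

Lemma act_vert g v : act g (vert R v) = vert R (a g v).
Proof.
apply: eq_point => /=; apply/funext => w; rewrite /edge_point /= !mul0r !addr0.
by rewrite -(can_eq (gactK g)) -gactM mulgV gact1.
Qed.

Lemma iter_act n g x : iter n (act g) x = act (g ^+ n)%g x.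
Proof.
elim: n => [|n ih]; first by rewrite expg0 act1.
by rewrite iterS ih -actM expgS.
Qed.

Lemma gd_act g u v : gd (a g u) (a g v) = gd u v.
Proof.
suff h k x y : (gd (a k x) (a k y) <= gd x y)%N.
  by apply/eqP; rewrite eqn_leq h/= -{1}(gactK g u) -{1}(gactK g v) h.
have [p [xp <- <-]] := gd_path x y.
rewrite -last_map -(size_map (a k)); apply: gd_le.
by rewrite path_map; apply: sub_path xp => z t; rewrite /= gact_adj.
Qed.

End Action.

(** * Vertex stabilisers and the scale of inner automorphisms *)

Section Inner.
Local Open Scope group_scope.
Variable G : topologicalGroupType.
Implicit Types (g h u : G).

Lemma innerM g : {morph inner g : x y / x * y}.
Proof. by move=> x y; rewrite /inner !mulgA mulgVK. Qed.

Lemma innerK g : cancel (inner g) (inner g^-1).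
Proof. by move=> x; rewrite /inner invgK !mulgA mulVg mul1g mulgVK. Qed.

Lemma innerVK g : cancel (inner g^-1) (inner g).
Proof. by move=> x; rewrite /inner invgK !mulgA mulgV mul1g mulgK. Qed.

Lemma inner_continuous g : continuous (inner g).
Proof.
move=> x; apply: (@cvg_comp _ _ _ (fun x => g * x) (fun y => y * g^-1) _ (nbhs (g * x))).
  exact: mulgl_continuous.
exact: mulgr_continuous.
Qed.

Lemma iter_inner n g : iter n (inner g) = inner (g ^+ n).
Proof.
apply/funext => x; elim: n => [|n ih];
  first by rewrite expg0 /inner invg1 mul1g mulg1.
by rewrite iterS ih /inner expgS invgM !mulgA.
Qed.

Lemma inner_subgroup g (U : set G) : subgroup U -> subgroup (inner g @` U).
Proof. exact: subgroup_image (innerM g). Qed.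

Lemma inner_COS g (U : set G) : COS U -> COS (inner g @` U).
Proof.
exact: (COS_image (innerM g) (@innerK g) (@innerVK g) (@inner_continuous g)
  (@inner_continuous g^-1) 1).
Qed.

Lemma inner_idx g (S U : set G) : subgroup U -> fin_idx S U ->
  fin_idx (inner g @` S) (inner g @` U) /\ idx (inner g @` S) (inner g @` U) = idx S U.
Proof. by apply: idx_image; [exact: innerM | exact: can_inj (@innerK g)]. Qed.

Lemma inner_image_comp g h (U : set G) : inner g @` (inner h @` U) = inner (g * h) @` U.
Proof.
rewrite image_comp; apply: eq_imagel => x _.
by rewrite /inner /= invgM !mulgA.
Qed.

Lemma idx_iter_le g n (W : set G) : COS W ->
  (idx (inner (g ^+ n) @` W) W <= idx (inner g @` W) W ^ n)%N.
Proof.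
move=> cW; have gW : subgroup W by case: cW.
elim: n => [|n ih].
  by rewrite -(iter_inner 0) image_id idx_self//; exact: subgroup1.
rewrite expgSr -inner_image_comp expnSr.
have f1 := COS_fin_idx (inner_COS g cW) cW.
have [f2 e2] := inner_idx (g ^+ n) gW f1.
have gA : subgroup (inner g @` W) by exact: inner_subgroup.
apply: leq_trans (idx_trans _ _ _ f2 (COS_fin_idx (inner_COS _ cW) cW)).2 _ => //;
  try exact: inner_subgroup.
by rewrite e2 mulnC leq_mul2r ih orbT.
Qed.

End Inner.

Section ActionIndex.
Variables (G : topologicalGroupType) (Gamma : connected_graph) (a : graph_action G Gamma).
Hypothesis lf : locally_finite Gamma.
Hypothesis tra : vertex_transitive a.
Hypothesis stab : forall v : Gamma, compact (stabiliser a v) /\ open (stabiliser a v).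
Implicit Types (g h u : G) (p q v : Gamma).
Notation St := (stabiliser a).
Local Open Scope group_scope.

Lemma stab_subgroup v : subgroup (St v).
Proof.
split; first by rewrite /stabiliser /= gact1.
move=> x y; rewrite /stabiliser /= => xv yv.
by rewrite gactM -{1}yv gactK.
Qed.
Hint Resolve stab_subgroup : core.

Lemma stab_COS v : COS (St v).
Proof. by have [cS oS] := stab v. Qed.
Hint Resolve stab_COS : core.

Lemma inner_stab g v : inner g @` (St v) = St (a g v).
Proof.
apply/seteqP; split=> [_ [x xv <-]|x xv].
  by rewrite /stabiliser /inner /= !gactM gactK xv.
exists (inner g^-1 x); last by rewrite innerVK.
rewrite /stabiliser /inner /= invgK gactM gactM; move: xv;
  rewrite /stabiliser /= => ->.
by rewrite gactK.
Qed.

Lemma stab_fin p q : fin_idx (St p) (St q).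
Proof. exact: COS_fin_idx. Qed.
Hint Resolve stab_fin : core.

Lemma lcos_stab q u : lcos (St q) u = [set z | a z q = a u q].
Proof.
apply/seteqP; split=> [_ [w wq <-]|z zq] /=; first by rewrite gactM wq.
by exists (u^-1 * z); rewrite ?mulVKg// /stabiliser /= gactM zq gactK.
Qed.

(** A coset of [St q] is determined by the image of [q]; by transitivity the
number of vertices at distance at most [C] from [q] does not depend on
[q]. *)
Lemma moved_idx (C : nat) : exists B, forall (S : set G) q,
  (forall u, S u -> (gd (a u q) q <= C)%N) -> fin_idx S (St q) /\ (idx S (St q) <= B)%N.
Proof.
have [v _] := cgraph_nonempty Gamma.
pose N := [set u | (gd (a u v) v <= C)%N].
have fN : fin_idx N (St v).
  apply: (@sub_finite_set _ _ ((fun w => [set z | a z v = w]) @` [set w | (gd v w <= C)%N])).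
    by move=> _ [u Nu <-]; exists (a u v);
      [rewrite /= gd_sym | rewrite lcos_stab].
  exact: finite_image (finite_ball lf v C).
exists (idx N (St v)) => S q SC; have [x xq] := tra v q; subst q.
have SN : inner x^-1 @` S `<=` N.
  move=> _ [u Su <-]; rewrite /N /= /inner invgK !gactM -(gd_act a x) -gactM mulgV gact1.
  exact: SC.
have f := fin_idx_subset_l SN fN.
have [f' e'] := inner_idx x (stab_subgroup v) f.
rewrite inner_image_comp mulgV inner_stab in f' e'.
have i1 : inner 1 @` S = S by rewrite -(iter_inner 0 1) image_id.
rewrite i1 in f' e'; split => //; rewrite e'.
exact: idx_subset_l.
Qed.

(** Indices are submultiplicative along a path, and bounded for adjacent
vertices. *)
Lemma idx_growth : exists D, forall p q, (idx (St p) (St q) <= D ^ gd p q)%N.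
Proof.
have [B hB] := moved_idx 2; exists (maxn B 1) => p q.
have hadj p' q' : adj p' q' -> (idx (St p') (St q') <= maxn B 1)%N.
  move=> pq; have [|_ le] := hB (St p') q'; last by rewrite leq_max le.
  move=> u up.
  have := gd_triangle p' (a u q') q'; rewrite -{1}up gd_act (gd_sym q').
  by have := gd_adj pq; lia.
move e : (gd p q) => n; elim: n p e => [|n ih] p.
  by move/gd_eq0 => ->; rewrite idx_self//;
    exact: (subgroup1 (stab_subgroup q)).
move=> e; have [|w [pw e']] := @gd_next _ p q; first by rewrite e.
rewrite expnS; apply: leq_trans (idx_trans _ _ _ (stab_fin p w) (stab_fin w q)).2 _ => //.
by apply: leq_mul; [exact: hadj | apply: ih; rewrite e in e'; case: e'].
Qed.

Section Base.
Variable v : Gamma.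
Notation O g n := (a (g ^+ n) v).

Lemma scale_growth_inner g : exists V, [/\ COS V, V `<=` St v &
  forall n, (scale (inner g) ^ n <= idx (plus (inner g^-1) V n) V)%N].
Proof.
exact: (scale_growth (innerM g) (@innerK G g) (@innerVK G g)
  (@inner_continuous G g) (@inner_continuous G g^-1) (stab_COS v)).
Qed.

Lemma scale_le_orbit g : exists2 C, (0 < C)%N & forall n,
  (scale (inner g) ^ n <= C * idx (St (O g n)) (St v))%N.
Proof.
have [V [cV VS hV]] := scale_growth_inner g; have [gV _ _] := cV.
have fVS : fin_idx (St v) V by exact: COS_fin_idx.
exists (idx (St v) V) => [|n]; first by apply: idx_gt0 => //;
  exact: (subgroup1 (stab_subgroup v)).
apply: leq_trans (hV n) _.
have PV : plus (inner g^-1) V n `<=` St (O g n).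
  rewrite -inner_stab -iter_inner => u Pu.
  exists (iter n (inner g^-1) u); first by apply: VS; exact: Pu.
  exact: iter_cancel (@innerVK G g) u.
have [f le] := idx_trans (stab_subgroup (O g n)) (stab_subgroup v) gV (stab_fin _ _) fVS.
by apply: leq_trans (idx_subset_l PV f) _; rewrite mulnC.
Qed.

Lemma orbit_le_scale g : exists C, forall n,
  (idx (St (O g n)) (St v) <= C * scale (inner g) ^ n)%N.
Proof.
have [W cW sW] : exists2 W, COS W & idx (inner g @` W) W = scale (inner g).
  have [+ _] := least_nat (ex_intro2 _ _ (St v) (stab_COS v)
    (erefl (index_cap (inner g @` (St v)) (St v)))
    : [set index_cap (inner g @` U) U | U in @COS G] _).
  move=> [W cW e]; exists W => //; rewrite -index_capE//;
    first by apply: inner_subgroup; case: cW.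
    by case: cW.
  by apply: COS_fin_idx => //; exact: inner_COS.
have [gW _ _] := cW.
exists (idx (St v) W * idx W (St v))%N => n.
have f1 : fin_idx (St v) W by exact: COS_fin_idx.
have f2 : fin_idx W (St v) by exact: COS_fin_idx.
have f3 : fin_idx (inner (g ^+ n) @` W) W by apply: COS_fin_idx => //;
  exact: inner_COS.
have [f1' e1'] := inner_idx (g ^+ n) gW f1; rewrite inner_stab in f1' e1'.
have gW' := inner_subgroup (g ^+ n) gW.
have [f4 le4] := idx_trans gW' gW (stab_subgroup v) f3 f2.
have [_ le5] := idx_trans (stab_subgroup (O g n)) gW' (stab_subgroup v) f1' f4.
apply: leq_trans le5 _; rewrite e1' -mulnA leq_mul2l; apply/orP; right.
by apply: leq_trans le4 _; rewrite mulnC leq_mul2l -sW idx_iter_le ?orbT//.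
Qed.

(** Up to a constant, the index along the orbit is at least [2^n] by
[scale_le_orbit]; by [idx_growth] it is at most exponential in the distance. *)
Lemma orbit_linear g : moves_to_infinity (inner g) -> exists e c, forall n,
  (n <= e * gd v (O g n) + c)%N.
Proof.
move=> sg; have [C C0 hC] := scale_le_orbit g; have [D hD] := idx_growth.
exists D, C => n; rewrite -(@leq_exp2l 2)// expnD expnM.
apply: (@leq_trans (scale (inner g) ^ n)); first by case: n => // n;
  rewrite leq_exp2r.
apply: leq_trans (hC n) _; rewrite mulnC; apply: leq_mul;
  last exact: ltnW (ltn_expl _ _).
apply: leq_trans (hD _ _) _; rewrite gd_sym.
by case: (gd v _) => // k; rewrite leq_exp2r// ltnW// ltn_expl.
Qed.

End Base.
End ActionIndex.

(** * Orbits of elements moving towards infinity *)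

Section Orbits.
Variables (R : realType) (G : topologicalGroupType) (Gamma : connected_graph).
Variable a : graph_action G Gamma.
Variable delta : R.
Notation X := (realization R Gamma).
Hypothesis lf : locally_finite Gamma.
Hypothesis tra : vertex_transitive a.
Hypothesis stab : forall v : Gamma, compact (stabiliser a v) /\ open (stabiliser a v).
Hypothesis four : forall x y z p : X,
  gromov_product p x y >= Num.min (gromov_product p x z) (gromov_product p y z) - delta.
Implicit Types (g h u : G) (p q : Gamma).
Notation St := (stabiliser a).
Notation act := (@point_action R G Gamma a).
Notation d := (@mdist R X).
Notation eqv := (@equivalent_at_infinity R X).
Variable v : Gamma.
Notation O g n := (a (g ^+ n)%g v).
Notation x := (vert R v).

Definition orb g : nat -> X := fun n => iter n (act g) x.

Lemma orbE g n : orb g n = vert R (O g n).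
Proof. by rewrite /orb iter_act act_vert. Qed.

Lemma hyp_axis g : moves_to_infinity (inner g) -> exists K, quasi_axis x (act g) K.
Proof.
move=> mg; have [e [c hec]] := orbit_linear lf tra stab v mg.
have lin n : (e.+1%:R)^-1 * n%:R - (e.+1%:R)^-1 * c%:R <= d x (orb g n).
  rewrite orbE mdist_vert -mulrBr ler_pdivrMl ?ltr0n// lerBlDr.
  rewrite -natrM -natrD ler_nat; apply: leq_trans (hec n) _.
  by rewrite leq_add2r leq_mul2r leqnSn orbT.
have e0 : 0 < (e.+1%:R)^-1 :> R by rewrite invr_gt0 ltr0n.
have [|K hK] := orbit_quasigeodesic four (act_isometry a g) e0 _ lin;
  first by rewrite mulr_ge0// ltW.
exists K; split => //; first exact: act_isometry.
move=> M; exists (Num.truncn (e.+1%:R * M + c%:R)).+1 => n hn.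
apply: le_trans (lin n); rewrite -mulrBr mulrC ler_pdivlMr ?ltr0n//.
have : e.+1%:R * M + c%:R < n%:R by apply: lt_le_trans (truncnS_gt _) _;
  rewrite ler_nat.
by rewrite mulrC; lra.
Qed.

Lemma limit_ray (g : G) : eqv (orb g) (orb g) ->
  exists2 r : R -> X, geodesic_ray r & eqv (ray_seq r) (orb g).
Proof.
move=> h; have e : orb g = @vert R Gamma \o (fun n => O g n) by apply/funext => n; exact: orbE.
by rewrite e; apply: (ray_to_limit four lf _ v); rewrite -e.
Qed.

Lemma orb_eqv g : moves_to_infinity (inner g) -> eqv (orb g) (orb g).
Proof. by move=> /hyp_axis[K [gI aoo aK]]; exact: orbit_eqv. Qed.

Lemma orb_attracting g : moves_to_infinity (inner g) ->
  exists2 r : R -> X, geodesic_ray r /\ eqv (ray_seq r) (orb g) &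
    attracting_point (act g) (ray_class r).
Proof.
move=> mg; have [K [gI aoo aK]] := hyp_axis mg.
have g'I := inv_isometry gI (actVK a g).
have dV := dist_iter_inv gI (actVK a g).
have [rp rrp hp] := limit_ray (orb_eqv mg).
have [|rm rrm hm] := @limit_ray g^-1%g.
  apply: (@orbit_eqv _ _ _ g'I _ _ K).
    by move=> M; have [N hN] := aoo M; exists N => n; rewrite dV; exact: hN.
  by move=> m n; rewrite !dV.
exists rp => //; exact: (attracting_orbit four gI (actK a g) (actVK a g) aoo aK rrp hp rrm hm).
Qed.

Lemma gd_le_truncn p q (D : R) : d (vert R p) (vert R q) <= D -> (gd p q <= Num.truncn D)%N.
Proof.
rewrite mdist_vert => h; rewrite truncn_ge_nat//; exact: le_trans h.
Qed.

(** Elements fixing both [g^n v] and [h^k v] move [v] a bounded distance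
([fix_two_close]), hence meet boundedly many cosets of the stabiliser of
[v]. *)
Lemma distinct_ends g h : moves_to_infinity (inner g) -> moves_to_infinity (inner h) ->
  ~ eqv (orb g) (orb h) -> exists2 C, (0 < C)%N & forall n k,
    (scale (inner g) ^ n <= C * idx (St (O g n)) (St (O h k)))%N.
Proof.
move=> mg mh ngh.
have [B hB] := not_eqv_bounded four x (orb_eqv mg) (orb_eqv mh) ngh.
have [C1 C10 hC1] := scale_le_orbit stab v g.
have [C2 hC2] := moved_idx lf tra (Num.truncn (2 * B + 2 * delta)).
exists (C1 * C2.+1)%N => [|n k]; first by rewrite muln_gt0 C10.
apply: leq_trans (hC1 n) _; rewrite -mulnA leq_mul2l; apply/orP; right.
have gS := stab_subgroup a.
have [|f le] := hC2 (St (O g n) `&` St (O h k)) v.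
  move=> u [u1 u2]; apply: gd_le_truncn; rewrite -act_vert.
  by apply: (fix_two_close four (act_isometry a u) _ _ (hB n k));
    rewrite orbE act_vert ?u1 ?u2.
have fi := stab_fin stab.
have e := idxI (gS (O g n)) (gS (O h k)) (gS v) (fi _ _) f.
have fS : fin_idx (St (O g n)) (St (O h k) `&` St v) by apply: fin_idxI.
have [_ le2] := idx_subset_r (gS v) (@subIsetr _ (St (O h k)) (St v)) fS (subgroupI (gS _) (gS _)).
apply: leq_trans le2 _; rewrite e mulnC leq_mul2r; apply/orP; right.
exact: leqW.
Qed.



Lemma gd_orbit_le h n : (gd v (O h n) <= n * gd v (a h v))%N.
Proof.
elim: n => [|n ih]; first by rewrite expg0 gact1 gdxx.
apply: leq_trans (gd_triangle (O h n) _ _) _.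
by rewrite expgSr gactM gd_act mulSn addnC leq_add2l.
Qed.

Lemma gd_orbit_shift h i j : (i <= j)%N -> (gd (O h i) (O h j) <= (j - i) * gd v (a h v))%N.
Proof.
by move=> ij; rewrite -{1}(subnKC ij) expgnDr gactM gd_act; exact: gd_orbit_le.
Qed.

(** * The modular function of the stabiliser of an end *)

Section SameEnd.
Variables g h : G.
Hypothesis mg : moves_to_infinity (inner g).
Hypothesis mh : moves_to_infinity (inner h).
Hypothesis gh : eqv (orb g) (orb h).

(** The stabiliser of the common limit of the two orbits, described without
reference to rays. *)
Definition end_stab : set G := [set u | eqv (act u \o orb g) (orb g)].
Notation P := end_stab.

Lemma end_stab_subgroup : subgroup P.
Proof.
have gI u := act_isometry (R := R) a u.
split.
  rewrite /end_stab /= (_ : _ \o _ = orb g); first exact: orb_eqv.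
  by apply/funext => n /=; rewrite act1.
move=> y z Py Pz; rewrite /end_stab /=.
have e : act (y * z^-1)%g \o orb g = act y \o (act z^-1%g \o orb g).
  by apply/funext => n /=; rewrite actM.
rewrite e; apply: (eqv_trans four) Py; apply: eqv_isometry => //.
have := eqv_isometry (gI z^-1%g) Pz.
rewrite (_ : _ \o (_ \o _) = orb g) => [/eqv_sym//|].
by apply/funext => n /=; rewrite actK.
Qed.
Hint Resolve end_stab_subgroup : core.

Lemma end_stabE u : P u <-> eqv (act u \o orb h) (orb h).
Proof.
have gI := act_isometry (R := R) a u.
split=> Pu.
  apply: (eqv_trans four) gh; apply: (eqv_trans four) Pu.
  by apply: eqv_isometry => //; exact: eqv_sym.
apply: (eqv_trans four) (eqv_sym gh); apply: (eqv_trans four) Pu.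
exact: eqv_isometry.
Qed.

Lemma end_stab_g : P g.
Proof.
have := eqv_shift (orb_eqv mg).
by congr eqv; apply/funext => n.
Qed.

Lemma end_stab_h : P h.
Proof.
apply/end_stabE; have := eqv_shift (orb_eqv mh).
by congr eqv; apply/funext => n.
Qed.

Definition end_stab_at q : set G := P `&` St q.
Notation Ps := end_stab_at.

Lemma end_stab_at_subgroup q : subgroup (Ps q).
Proof. by apply: subgroupI => //; exact: stab_subgroup. Qed.
Hint Resolve end_stab_at_subgroup : core.

Lemma end_stab_at_idx p q : fin_idx (Ps p) (Ps q) /\ idx (Ps p) (Ps q) = idx (Ps p) (St q).
Proof.
have gS := stab_subgroup a.
have e : Ps p `&` Ps q = Ps p `&` St q.
  by apply/seteqP; split=> u [[? ?]]; [move=> [? ?] | move=> ?]; do !split.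
have f : fin_idx (Ps p) (St q) by apply: fin_idx_subset_l (stab_fin stab p q) => u [].
have f1 := fin_idxIr (end_stab_at_subgroup p) (gS q) f; rewrite -e in f1.
have [f2 _] := idx_subset_r (end_stab_at_subgroup q) (@subIsetr _ (Ps p) (Ps q)) f1
  (subgroupI (end_stab_at_subgroup p) (end_stab_at_subgroup q)).
by split => //; rewrite -(idxIr (end_stab_at_subgroup p) (end_stab_at_subgroup q) f2) e idxIr.
Qed.

Lemma end_stab_at_idx_le p q : (idx (Ps p) (Ps q) <= idx (St p) (St q))%N.
Proof.
rewrite (end_stab_at_idx p q).2; apply: idx_subset_l; last exact: stab_fin.
by move=> u [].
Qed.

Lemma end_stab_at_idx_gt0 p q : (0 < idx (Ps p) (Ps q))%N.
Proof. by apply: idx_gt0 => //;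
  [exact: (end_stab_at_idx p q).1 | exact: subgroup1 (end_stab_at_subgroup p)]. Qed.

Lemma end_stab_at_inner u q : P u -> inner u @` (Ps q) = Ps (a u q).
Proof.
move=> Pu; rewrite /Ps -inner_stab; apply/seteqP;
  split=> [_ [z [Pz zq] <-]|t [Pz [z zq e]]].
  split; last by exists z.
  by rewrite /inner; apply: end_stab_subgroup.2 => //;
    exact: (subgroupM end_stab_subgroup).
exists z => //; split => //; move: Pz; rewrite -e /inner => Pz.
by apply: (subgroupMl end_stab_subgroup Pu);
  exact: (subgroupMr end_stab_subgroup (subgroupV end_stab_subgroup Pu)).
Qed.

(** The Haar measure of the stabiliser of [p] in the end stabiliser, divided by
that of [q]. *)
Definition end_ratio p q : R := (idx (Ps p) (Ps q))%:R / (idx (Ps q) (Ps p))%:R.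

Lemma end_ratio_gt0 p q : 0 < end_ratio p q.
Proof. by rewrite divr_gt0// ltr0n end_stab_at_idx_gt0. Qed.

Lemma end_ratio_cocycle p q r : end_ratio p q * end_ratio q r = end_ratio p r.
Proof.
have fi y z := (end_stab_at_idx y z).1.
have := idx_cocycle (end_stab_at_subgroup p) (end_stab_at_subgroup q) (end_stab_at_subgroup r)
  (fi p q) (fi q p) (fi q r) (fi r q) (fi p r) (fi r p).
have pos y z : (idx (Ps y) (Ps z))%:R != 0 :> R by rewrite pnatr_eq0 -lt0n end_stab_at_idx_gt0.
move=> /(congr1 (fun n => n%:R : R)); rewrite !natrM /end_ratio => e.
rewrite mulf_div; apply/eqP; rewrite eqr_div ?mulf_neq0//; apply/eqP.
by rewrite e; ring.
Qed.

Lemma end_ratio_act u p q : P u -> end_ratio (a u p) (a u q) = end_ratio p q.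
Proof.
move=> Pu; rewrite /end_ratio -!end_stab_at_inner//.
have [_ ->] := inner_idx u (end_stab_at_subgroup q) (end_stab_at_idx p q).1.
by have [_ ->] := inner_idx u (end_stab_at_subgroup p) (end_stab_at_idx q p).1.
Qed.

(** A modular function of the end stabiliser. It depends only on [u v], which
makes the pigeonhole argument of [same_end_close] possible. *)
Definition modulus u : R := end_ratio (a u v) v.

Lemma modulus_gt0 u : 0 < modulus u.
Proof. exact: end_ratio_gt0. Qed.

Lemma modulusM u z : P u -> modulus (u * z)%g = modulus u * modulus z.
Proof.
move=> Pu; rewrite /modulus gactM -(end_ratio_cocycle (a u (a z v)) (a u v) v) end_ratio_act//.
by rewrite mulrC.
Qed.

Lemma modulus1 : modulus 1%g = 1.
Proof.
have := modulusM 1%g (subgroup1 end_stab_subgroup); rewrite mulg1 => e.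
by apply/esym/(mulfI (lt0r_neq0 (modulus_gt0 1%g))); rewrite mulr1.
Qed.

Lemma modulusV u : P u -> modulus u^-1%g = (modulus u)^-1.
Proof.
move=> Pu; apply/(mulfI (lt0r_neq0 (modulus_gt0 u))).
by rewrite -modulusM// mulgV modulus1 mulfV// lt0r_neq0// modulus_gt0.
Qed.

Lemma modulusX u n : P u -> modulus (u ^+ n)%g = modulus u ^+ n.
Proof.
move=> Pu; elim: n => [|n ih]; first by rewrite expg0 modulus1.
by rewrite expgS exprS modulusM// ih.
Qed.

Lemma end_stabX u n : P u -> P (u ^+ n)%g.
Proof.
move=> Pu; elim: n => [|n ih]; first exact: (subgroup1 end_stab_subgroup).
by rewrite expgS; exact: (subgroupM end_stab_subgroup).
Qed.

Lemma modulus_bounded (C : nat) : exists2 M : R, 1 <= M &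
  forall u, (gd v (a u v) <= C)%N -> modulus u <= M /\ 1 <= M * modulus u.
Proof.
have [D hD] := idx_growth lf tra stab.
exists (D.+1 ^ C)%:R => [|u uC]; first by rewrite ler1n expn_gt0.
have bd p q : (gd p q <= C)%N -> (idx (Ps p) (Ps q))%:R <= (D.+1 ^ C)%:R :> R.
  move=> pqC; rewrite ler_nat; apply: leq_trans (end_stab_at_idx_le p q) _.
  apply: leq_trans (hD p q) _; apply: (@leq_trans (D.+1 ^ gd p q)).
    by case: (gd p q) => // k; rewrite leq_exp2r.
  exact: leq_pexp2l.
have ge1 p q : 1 <= (idx (Ps p) (Ps q))%:R :> R by rewrite ler1n end_stab_at_idx_gt0.
have gt0 p q : 0 < (idx (Ps p) (Ps q))%:R :> R by rewrite ltr0n end_stab_at_idx_gt0.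
rewrite /modulus /end_ratio; split.
  rewrite ler_pdivrMr//; apply: le_trans (bd _ _ _) _; first by rewrite gd_sym.
  by rewrite ler_peMr// ler0n.
rewrite mulrA ler_pdivlMr// mul1r; apply: le_trans (bd _ _ uC) _.
by rewrite ler_peMr// ler0n.
Qed.

(** Were the modulus at most 1, the index of [P_v] in [P_(h^n v)] would be at most
the reverse index, which is bounded because elements of [P_v] move the [h^n v]
a bounded distance. But it is at least [scale^n] up to a constant, by
[scale_growth], since the group [V+] found there fixes almost all [h^i v] and
so lies in [P]. *)
Lemma modulus_h_gt1 : 1 < modulus h.
Proof.
rewrite ltNge; apply/negP => le1.
have [V [cV VS hV]] := scale_growth_inner stab v h; have [gV _ _] := cV.
have [K axis] := hyp_axis mh.
have [B hB] := moved_idx lf tra (Num.truncn (K + 4 * delta)).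
have gS := stab_subgroup a.
have fVS : fin_idx (St v) V by apply: COS_fin_idx => //; exact: stab_COS.
(* The exponent [M] at which the bounded quantity is overtaken by [2 ^ M]. *)
pose M := (idx (St v) V * B)%N.
suff : (2 ^ M <= M)%N by rewrite leqNgt ltn_expl.
apply: (@leq_trans (scale (inner h) ^ M)); first by case: (M) => // k;
  rewrite leq_exp2r.
apply: leq_trans (hV M) _.
have PV : plus (inner h^-1%g) V M `<=` Ps (O h M).
  move=> u Pu.
  have fixu i : (M <= i)%N -> a u (O h i) = O h i.
    move=> Mi; suff : St (O h i) u by [].
    rewrite -inner_stab -iter_inner.
    exists (iter i (inner h^-1%g) u); first by apply: VS; exact: Pu.
    exact: iter_cancel (@innerVK G h) u.
  split; last exact: fixu.
  apply/end_stabE => p N; have [N' hN'] := orb_eqv mh p N.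
  exists (maxn N' M) => i j; rewrite !geq_max => /andP[iN iM] /andP[jN jM].
  by rewrite /= orbE act_vert fixu// -orbE; exact: hN'.
have f1 : fin_idx (Ps (O h M)) (St v) by apply: fin_idx_subset_l (stab_fin stab (O h M) v) => u [].
have [f le] := idx_trans (end_stab_at_subgroup (O h M)) (gS v) gV f1 fVS.
apply: leq_trans (idx_subset_l PV f) _; apply: leq_trans le _.
rewrite -(end_stab_at_idx _ _).2 mulnC leq_mul2l; apply/orP; right.
have [|_ le2] := hB (Ps v) (O h M).
  move=> u [Pu uv]; apply: gd_le_truncn; rewrite -act_vert -orbE.
  apply: (fix_limit_close four axis (act_isometry a u));
    first by rewrite act_vert uv.
  exact/end_stabE.
apply: leq_trans le2; rewrite -(end_stab_at_idx _ _).2.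
have eM : modulus (h ^+ M)%g <= 1.
  rewrite modulusX; last exact: end_stab_h.
  by apply: exprn_ile1 => //; rewrite ltW// modulus_gt0.
move: eM; rewrite /modulus /end_ratio ler_pdivrMr ?ltr0n ?end_stab_at_idx_gt0// mul1r.
by rewrite ler_nat.
Qed.

Lemma recurrence (w : nat -> Gamma) (C : nat) : (forall n, (gd v (w n) <= C)%N) ->
  exists z, forall N, exists2 n, (N <= n)%N & w n = z.
Proof.
move=> wC; have /finite_seqP[s sE] := finite_ball lf v C.
have ws n : w n \in s.
  by have : [set z | (gd v z <= C)%N] (w n) := wC n; rewrite sE.
apply: contrapT => /forallNP noz.
have [n hn] : exists n, forall z, z \in s -> forall m, (n <= m)%N -> w m <> z.
  apply: finite_uniform => z _; have /existsNP[N hN] := noz z.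
  by exists N => m Nm e; apply: hN; exists m.
exact: hn (ws n) n (leqnn n) erefl.
Qed.

Lemma expr_unbounded (y M : R) : 1 < y -> exists n : nat, M < y ^+ n.
Proof.
move=> y1; have ym : 0 < y - 1 by lra.
exists (Num.truncn (`|M| / (y - 1))).+1; set n := _.+1.
have h1 : 1 + n%:R * (y - 1) <= y ^+ n.
  elim: n => [|n ih]; first by rewrite mul0r addr0.
  have : 0 <= n%:R * ((y - 1) * (y - 1)) by rewrite mulr_ge0// mulr_ge0// ltW.
  have : 0 <= (y - 1) * (y ^+ n - (1 + n%:R * (y - 1))) by rewrite mulr_ge0 ?subr_ge0// ltW.
  rewrite exprS -natr1; nra.
have h2 : `|M| < n%:R * (y - 1) by rewrite -ltr_pdivrMr//; exact: truncnS_gt.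
by have := ler_norm M; lra.
Qed.

(** Equality of the two vertices [u n0 v] and [u n1 v] gives equality of the
moduli, hence of those of [g^k] and [h^l] exactly, not only up to a bounded
factor. This commensurability of the two translation lengths is what keeps the
sequences [g^(n k) v] and [h^(n l) v] together. *)
Lemma same_end_close : exists k l C : nat, [/\ (0 < k)%N, (0 < l)%N &
  forall n, (gd (O g (n * k)) (O h (n * l)) <= C)%N].
Proof.
have [K axg] := hyp_axis mg; have [L axh] := hyp_axis mh.
have [C0 hC0] := orbits_fellow four axg axh gh.
pose C := Num.truncn C0.
have [m hm] : {m : nat -> nat & forall n, (gd (O g n) (O h (m n)) <= C)%N}.
  apply: (@choice _ _ (fun n m => (gd (O g n) (O h m) <= C)%N)) => n.
  have [m hm] := hC0 n; exists m; apply: gd_le_truncn.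
  by have := hm; rewrite -/(orb g n) -/(orb h m) !orbE.
pose u n := ((g ^+ n)^-1 * h ^+ (m n))%g.
have uC n : (gd v (a (u n) v) <= C)%N.
  by rewrite /u gactM -(gd_act a (g ^+ n)%g) -!gactM mulgV mul1g.
have Pg := end_stab_g; have Ph := end_stab_h.
have modu n : modulus (u n) = modulus h ^+ m n / modulus g ^+ n.
  rewrite /u modulusM; last by apply: (subgroupV end_stab_subgroup);
    exact: end_stabX.
  by rewrite modulusV ?(modulusX _ Pg) ?(modulusX _ Ph) 1?mulrC//;
    exact: end_stabX.
have [z hz] := recurrence uC.
have [n0 _ e0] := hz 0%N.
have [N hN] : exists N, forall n, (N <= n)%N -> (m n0 < m n)%N.
  have [_ aoo _] := axg.
  have [N hN] := aoo (m n0 * gd v (a h v) + C).+1%:R; exists N => n Nn.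
  rewrite ltnNge; apply/negP => mle.
  have := hN n Nn; rewrite -/(orb g n) orbE mdist_vert ler_nat.
  have := gd_triangle (O h (m n)) v (O g n);
    rewrite (gd_sym (O h (m n)) (O g n)).
  have := hm n; have := gd_orbit_le h (m n).
  have : (m n * gd v (a h v) <= m n0 * gd v (a h v))%N by rewrite leq_mul2r mle orbT.
  by lia.
have [n1] := hz (maxn N n0.+1); rewrite geq_max => /andP[Nn1 n01] e1.
have m01 := hN n1 Nn1.
pose k := (n1 - n0)%N; pose l := (m n1 - m n0)%N.
have mh0 := modulus_gt0 h; have mg0 := modulus_gt0 g.
have mkl : modulus g ^+ k = modulus h ^+ l.
  have : modulus (u n0) = modulus (u n1) by rewrite /modulus e0 e1.
  rewrite !modu => /eqP; rewrite eqr_div ?expf_neq0 ?lt0r_neq0//.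
  have -> : modulus g ^+ n1 = modulus g ^+ n0 * modulus g ^+ k by rewrite -exprD subnKC// ltnW.
  have -> : modulus h ^+ m n1 = modulus h ^+ m n0 * modulus h ^+ l by rewrite -exprD subnKC// ltnW.
  move=> /eqP e.
  have nz : modulus h ^+ m n0 * modulus g ^+ n0 != 0 by rewrite mulf_neq0// expf_neq0// lt0r_neq0.
  by apply: (mulfI nz); rewrite -mulrA e; ring.
have [M M1 hM] := modulus_bounded C.
have [E hE] := expr_unbounded M modulus_h_gt1.
exists k, l, (C + E * gd v (a h v))%N; split; rewrite ?subn_gt0// => n.
have [hM1 hM2] := hM _ (uC (n * k)%N).
have eg : modulus g ^+ (n * k) = modulus h ^+ (n * l) by rewrite mulnC exprM mkl -exprM mulnC.
rewrite modu eg in hM1 hM2.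
set mm := m (n * k)%N in hM1 hM2; set j := (n * l)%N in hM1 hM2 *.
have pos i : 0 < modulus h ^+ i by rewrite exprn_gt0.
have near i i' : modulus h ^+ i <= M * modulus h ^+ i' -> (i < i' + E)%N.
  move=> hle; rewrite ltnNge; apply/negP => le.
  have : modulus h ^+ (i' + E) <= modulus h ^+ i by apply: ler_weXn2l => //;
    exact: ltW modulus_h_gt1.
  move=> /le_trans/(_ hle); rewrite exprD mulrC ler_pM2r// leNgt hE//.
have d1 : (mm < j + E)%N by apply: near; move: hM1; rewrite ler_pdivrMr.
have d2 : (j < mm + E)%N by apply: near; move: hM2;
  rewrite mulrA ler_pdivlMr// mul1r.
apply: leq_trans (gd_triangle (O h mm) _ _) _; apply: leq_add; first exact: hm.
have [mj|/ltnW jm] := leqP mm j.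
  apply: leq_trans (gd_orbit_shift h mj) _; rewrite leq_mul2r; apply/orP;
    right; lia.
rewrite gd_sym; apply: leq_trans (gd_orbit_shift h jm) _; rewrite leq_mul2r;
  apply/orP; right; lia.
Qed.

End SameEnd.

End Orbits.

(** * Asymptotic classes and their distance *)

Section Limits.
Variable R : realType.

Lemma limn_esup_rate (s : nat -> R) (l D : R) :
  (forall n, (0 < n)%N -> `|s n - l| * n%:R <= D) ->
  limn_esup (fun n => (s n)%:E) = l%:E.
Proof.
move=> h; suff : (s n)%:E @[n --> \oo] --> l%:E by move=> /cvg_limn_einf_sup[].
apply/cvg_EFin; first by near=> n.
apply/cvgrPdist_le => /= e e0.
exists (Num.truncn (D / e)).+1 => // n /= hn.
have n0 : 0 < n%:R :> R by rewrite ltr0n; exact: leq_trans hn.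
rewrite distrC -(ler_pM2r n0); apply: le_trans (h n _) _;
  first by rewrite -(ltr0n R).
rewrite mulrC -ler_pdivrMr//; apply: le_trans (ltW (truncnS_gt _)) _;
  by rewrite ler_nat.
Unshelve. all: by end_near. Qed.

(** The minimum defining [delta_plus_seq] is attained, being over an increasing
function of indices, which are natural numbers. *)
Lemma least_image (f : nat -> R) (w : nat -> nat) (A : set nat) k0 :
  A k0 -> (forall i j, (w i <= w j)%N -> f i <= f j) ->
  exists2 k, A k & (forall j, A j -> (w k <= w j)%N) /\ least 0 [set f k | k in A] = f k.
Proof.
move=> Ak0 fw.
have [|m /asboolP[k Ak km] mmin] := @ex_minnP (fun m => `[< exists2 k, A k & w k = m >]).
  by exists (w k0); apply/asboolP; exists k0.
have kmin j : A j -> (w k <= w j)%N.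
  by move=> Aj; rewrite km; apply: mmin; apply/asboolP; exists j.
exists k => //; split => //.
have lk : ([set f k | k in A] `&` lbound [set f k | k in A]) (f k).
  by split; [exists k | move=> _ [j Aj <-]; apply: fw; exact: kmin].
rewrite /least; case: xgetP => [y _ [[j Aj <-] ly]|/(_ (f k))//].
apply/eqP; rewrite eq_le; apply/andP; split; last by apply: fw; exact: kmin.
by apply: ly; exists k.
Qed.

Lemma ln_nat_le (m n : nat) : (0 < m)%N -> (m <= n)%N -> ln (m%:R : R) <= ln n%:R.
Proof.
by move=> m0 mn; rewrite ler_ln ?posrE ?ltr0n// ?ler_nat//; exact: leq_trans mn.
Qed.

Lemma lnM_nat (m n : nat) : (0 < m)%N -> (0 < n)%N -> ln ((m * n)%:R : R) = ln m%:R + ln n%:R.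
Proof. by move=> m0 n0; rewrite natrM lnM ?posrE ?ltr0n. Qed.

Lemma lnX_nat (s n : nat) : (0 < s)%N -> ln ((s ^ n)%:R : R) = n%:R * ln s%:R.
Proof. by move=> s0; rewrite natrX lnXn ?ltr0n// mulr_natl. Qed.

End Limits.

Section Directions.
Variables (R : realType) (G : topologicalGroupType) (Gamma : connected_graph).
Variable a : graph_action G Gamma.
Variable delta : R.
Notation X := (realization R Gamma).
Hypothesis lf : locally_finite Gamma.
Hypothesis tra : vertex_transitive a.
Hypothesis stab : forall v : Gamma, compact (stabiliser a v) /\ open (stabiliser a v).
Hypothesis four : forall x y z p : X,
  gromov_product p x y >= Num.min (gromov_product p x z) (gromov_product p y z) - delta.
Implicit Types (g h u : G) (p q : Gamma).
Notation St := (stabiliser a).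
Notation act := (@point_action R G Gamma a).
Notation eqv := (@equivalent_at_infinity R X).
Variable v : Gamma.
Notation O g n := (a (g ^+ n)%g v).
Notation orb := (@orb R G Gamma a v).

Lemma conj_COS g n (U : set G) : COS U -> COS (iter n (inner g) @` U).
Proof. by rewrite iter_inner; exact: inner_COS. Qed.

Lemma conj_stab g n : iter n (inner g) @` (St v) = St (O g n).
Proof. by rewrite iter_inner inner_stab. Qed.

Lemma conj_idx g n (U V : set G) : COS U -> COS V ->
  idx (iter n (inner g) @` U) (iter n (inner g) @` V) = idx U V.
Proof.
move=> cU cV; rewrite iter_inner; have [gV _ _] := cV.
by have [] := inner_idx (g ^+ n)%g gV (COS_fin_idx cU cV).
Qed.

Lemma COS_idx_trans (U V W : set G) : COS U -> COS V -> COS W ->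
  (idx U W <= idx U V * idx V W)%N.
Proof.
move=> cU cV cW; have [gU _ _] := cU; have [gV _ _] := cV; have [gW _ _] := cW.
exact: (idx_trans gU gV gW (COS_fin_idx cU cV) (COS_fin_idx cV cW)).2.
Qed.

Lemma COS_idx_gt0 (U V : set G) : COS U -> COS V -> (0 < idx U V)%N.
Proof.
by move=> cU cV; apply: idx_gt0;
  [case: cV | exact: COS_fin_idx | case: cU => /subgroup1].
Qed.

Lemma COS_index_cap (U V : set G) : COS U -> COS V -> index_cap U V = idx U V.
Proof.
by move=> cU cV; rewrite index_capE//;
  [case: cU | case: cV | exact: COS_fin_idx].
Qed.

(** [U] and [U'] are commensurable, as are [V] and [V'], and conjugation
preserves indices. *)
Lemma idx_change g h n k (U V U' V' : set G) : COS U -> COS V -> COS U' -> COS V' ->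
  (idx (iter n (inner g) @` U) (iter k (inner h) @` V) <=
   idx U U' * idx V' V * idx (iter n (inner g) @` U') (iter k (inner h) @` V'))%N.
Proof.
move=> cU cV cU' cV'.
have c1 := conj_COS g n cU; have c2 := conj_COS g n cU'.
have c3 := conj_COS h k cV; have c4 := conj_COS h k cV'.
apply: leq_trans (COS_idx_trans c1 c2 c3) _; rewrite conj_idx//.
rewrite -mulnA leq_mul2l; apply/orP; right; rewrite mulnC.
by apply: leq_trans (COS_idx_trans c2 c4 c3) _; rewrite (conj_idx _ _ cV').
Qed.

(** As any two compact open subgroups are commensurable, asymptoticity can be
tested on the stabiliser of [v]. *)
Lemma asymptoticP g h : asymptotic R (inner g) (inner h) <->
  exists k l N : nat, [/\ (0 < k)%N, (0 < l)%N & forall n,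
    (idx (St (O g (n * k))) (St (O h (n * l))) <= N)%N /\
    (idx (St (O h (n * l))) (St (O g (n * k))) <= N)%N].
Proof.
have cS := stab_COS stab v.
split=> [[k [l [U [V [k0 l0 cU cV [C hC]]]]]]|[k [l [N [k0 l0 hN]]]]].
  pose N := Num.truncn (expR C).
  exists k, l, (idx (St v) U * idx V (St v) * N + idx (St v) V * idx U (St v) * N)%N; split => // n.
  have c1 := conj_COS g (n * k) cU; have c2 := conj_COS h (n * l) cV.
  have i1 := COS_idx_gt0 c1 c2; have i2 := COS_idx_gt0 c2 c1.
  have := hC n; rewrite /COS_dist !COS_index_cap// -ler_expR lnK ?posrE ?ltr0n ?muln_gt0 ?i1//.
  move=> h1; have hN : (idx (iter (n * k) (inner g) @` U) (iter (n * l) (inner h) @` V) *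
      idx (iter (n * l) (inner h) @` V) (iter (n * k) (inner g) @` U) <= N)%N.
    by rewrite truncn_ge_nat// expR_ge0.
  split; rewrite -!conj_stab.
    apply: leq_trans (idx_change g h _ _ cS cS cU cV) _;
      apply: leq_trans (leq_addr _ _).
    by rewrite leq_mul2l; apply/orP; right; apply: leq_trans hN;
      rewrite leq_pmulr.
  apply: leq_trans (idx_change h g _ _ cS cS cV cU) _;
    apply: leq_trans (leq_addl _ _).
  by rewrite leq_mul2l; apply/orP; right; apply: leq_trans hN;
    rewrite leq_pmull.
exists k, l, (St v), (St v); split => //.
exists (ln ((N * N)%:R)) => n; have [h1 h2] := hN n.
have c1 := conj_COS g (n * k) cS; have c2 := conj_COS h (n * l) cS.
rewrite /COS_dist !COS_index_cap//; apply: ln_nat_le.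
  by rewrite muln_gt0 !COS_idx_gt0.
by rewrite !conj_stab leq_mul.
Qed.

Lemma asymptotic_sym g h : asymptotic R (inner g) (inner h) -> asymptotic R (inner h) (inner g).
Proof.
move=> /asymptoticP[k [l [N [k0 l0 hN]]]]; apply/asymptoticP.
by exists l, k, N; split => // n; have [] := hN n.
Qed.

Lemma asymptotic_refl g : asymptotic R (inner g) (inner g).
Proof.
apply/asymptoticP; exists 1%N, 1%N, 1%N; split => // n.
by rewrite idx_self//; [exact: stab_subgroup | exact: (subgroup1 (stab_subgroup a _))].
Qed.

(** The step lengths are matched by passing to common multiples. *)
Lemma asymptotic_trans g h u : asymptotic R (inner g) (inner h) ->
  asymptotic R (inner h) (inner u) -> asymptotic R (inner g) (inner u).
Proof.
move=> /asymptoticP[k [l [N [k0 l0 hN]]]] /asymptoticP[l' [m [N' [l0' m0 hN']]]].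
apply/asymptoticP; exists (l' * k)%N, (l * m)%N, (N * N')%N.
rewrite !muln_gt0 k0 l0 l0' m0; split => // n.
have [h1 h2] := hN (n * l')%N; have [h3 h4] := hN' (n * l)%N.
rewrite !mulnA; rewrite (mulnAC n l' l) in h1 h2.
have t p q r : (idx (St p) (St r) <= idx (St p) (St q) * idx (St q) (St r))%N.
  by apply: COS_idx_trans; exact: stab_COS.
split; apply: leq_trans (t _ (O h (n * l * l')) _) _; first exact: leq_mul.
by rewrite mulnC; exact: leq_mul.
Qed.

Lemma direction_eq g h : asymptotic R (inner g) (inner h) -> direction R g = direction R h.
Proof.
move=> gh; apply/seteqP; split=> u; rewrite /direction /= => gu.
  exact: asymptotic_trans (asymptotic_sym gh) gu.
exact: asymptotic_trans gh gu.
Qed.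

Lemma same_end_asymptotic g h : moves_to_infinity (inner g) -> moves_to_infinity (inner h) ->
  eqv (orb g) (orb h) -> asymptotic R (inner g) (inner h).
Proof.
move=> mg mh gh; have [k [l [C [k0 l0 hC]]]] := same_end_close lf tra stab four mg mh gh.
have [D hD] := idx_growth lf tra stab.
apply/asymptoticP; exists k, l, (D.+1 ^ C)%N; split => // n.
have hDC p q : (gd p q <= C)%N -> (idx (St p) (St q) <= D.+1 ^ C)%N.
  move=> pq; apply: leq_trans (hD p q) _; apply: (@leq_trans (D.+1 ^ gd p q)).
    by case: (gd p q) => // j; rewrite leq_exp2r.
  exact: leq_pexp2l.
by split; apply: hDC; rewrite // gd_sym.
Qed.

Lemma asymptotic_same_end g h : moves_to_infinity (inner g) -> moves_to_infinity (inner h) ->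
  asymptotic R (inner g) (inner h) -> eqv (orb g) (orb h).
Proof.
move=> mg mh /asymptoticP[k [l [N [k0 l0 hN]]]]; apply: contrapT => ngh.
have [C C0 hC] := distinct_ends lf tra stab four mg mh ngh.
suff : (2 ^ (C * N) <= C * N)%N by rewrite leqNgt ltn_expl.
set n := (C * N)%N; have [h1 _] := hN n.
apply: (@leq_trans (scale (inner g) ^ (n * k))).
  apply: (@leq_trans (2 ^ (n * k))); first by rewrite leq_exp2l// leq_pmulr.
  by case: (n * k)%N => // j; rewrite leq_exp2r.
by apply: leq_trans (hC _ (n * l)%N) _; rewrite leq_mul2l h1 orbT.
Qed.

Lemma scale_inner_gt0 g : (0 < scale (inner g))%N.
Proof.
have cS := stab_COS stab v.
have [+ _] := least_nat (ex_intro2 _ _ (St v) cS (erefl (index_cap (inner g @` (St v)) (St v)))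
    : [set index_cap (inner g @` U) U | U in @COS G] _).
by move=> [W cW]; rewrite -/(scale _) => <-;
  rewrite COS_index_cap ?COS_idx_gt0//; exact: inner_COS.
Qed.

Lemma scale_id_le1 g : (scale (iter 0 (inner g)) <= 1)%N.
Proof.
have cS := stab_COS stab v.
have [_] := least_nat (ex_intro2 _ _ (St v) cS
    (erefl (index_cap (iter 0 (inner g) @` (St v)) (St v)))
    : [set index_cap (iter 0 (inner g) @` U) U | U in @COS G] _).
rewrite -/(scale _) image_id COS_index_cap// idx_self//; first by case: cS.
exact: (subgroup1 (stab_subgroup a v)).
Qed.

(** The index at the minimising [k] is at least [scale^n / c1] by
[distinct_ends], and at most the index at [k = 0], which is at most
[c2 * scale^n]. Logarithms divided by [n * ln (scale)] differ from 1 by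
[O(1/n)]. *)
Lemma delta_plus1 g h : moves_to_infinity (inner g) -> moves_to_infinity (inner h) ->
  ~ eqv (orb g) (orb h) -> delta_plus (inner g) (inner h) (1%:E : \bar R).
Proof.
move=> mg mh ngh U V cU cV.
have cS := stab_COS stab v.
have [C1 C10 hC1] := distinct_ends lf tra stab four mg mh ngh.
have [C2 hC2] := orbit_le_scale stab v g.
pose c1 := (C1 * (idx (St v) U * idx V (St v)))%N.
pose c2 := (idx U (St v) * idx (St v) V * C2)%N.
set s := scale (inner g); have s1 : (1 < s)%N := mg; have s0 := ltnW s1.
pose i n k := idx (iter n (inner g) @` U) (iter k (inner h) @` V).
have i0 n k : (0 < i n k)%N by apply: COS_idx_gt0; exact: conj_COS.
have low n k : (s ^ n <= c1 * i n k)%N.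
  apply: leq_trans (hC1 n k) _; rewrite -mulnA leq_mul2l; apply/orP; right.
  by rewrite -!conj_stab; exact: idx_change.
have up n : (i n 0%N <= c2 * s ^ n)%N.
  apply: leq_trans (idx_change g h n 0 cU cV cS cS) _;
    rewrite /c2 -[X in (_ <= X)%N]mulnA leq_mul2l.
  by apply/orP; right; rewrite !conj_stab expg0 gact1.
have c10 : (0 < c1)%N by have := low 0%N 0%N; rewrite expn0 muln_gt0 => /andP[].
have c20 : (0 < c2)%N by have := leq_trans (i0 0%N 0%N) (up 0%N);
  rewrite muln_gt0 => /andP[].
have ls0 : 0 < ln (s%:R : R) by rewrite ln_gt0// ltr1n.
pose L := ln (s%:R : R).
apply: (@limn_esup_rate _ _ _ ((ln (c1%:R) + ln (c2%:R)) / L)) => n n0.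
have nR : 0 < n%:R :> R by rewrite ltr0n.
have nL : 0 < n%:R * L by rewrite mulr_gt0.
pose A := [set k | (scale (iter k (inner h)) <= scale (iter n (inner g)))%N].
have A0 : A 0%N.
  by apply: leq_trans (scale_id_le1 h) _; rewrite iter_inner scale_inner_gt0.
pose f k : R := ln (index_cap (iter n (inner g) @` U) (iter k (inner h) @` V))%:R / (n%:R * L).
have [|k Ak [kmin e]] := @least_image R f (i n) A 0%N A0.
  move=> j j' jj; rewrite /f !COS_index_cap; try exact: conj_COS.
  by rewrite ler_pM2r ?invr_gt0//; apply: ln_nat_le jj; exact: i0.
rewrite /delta_plus_seq -/s -/L {}e /f COS_index_cap;
  [|exact: conj_COS|exact: conj_COS].
rewrite -/(i n k).
have h1 : n%:R * L <= ln c1%:R + ln (i n k)%:R.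
  rewrite -lnM_nat ?i0// /L -lnX_nat//; apply: ln_nat_le => //;
    by rewrite expn_gt0 s0.
have h2 : ln (i n k)%:R <= ln c2%:R + n%:R * L.
  rewrite /L -lnX_nat// -lnM_nat ?expn_gt0 ?s0//; apply: ln_nat_le => //.
  exact: leq_trans (kmin _ A0) (up n).
have p1 : 0 <= ln (c1%:R : R) by rewrite ln_ge0// ler1n.
have p2 : 0 <= ln (c2%:R : R) by rewrite ln_ge0// ler1n.
have -> : ln (i n k)%:R / (n%:R * L) - 1 = (ln (i n k)%:R - n%:R * L) / (n%:R * L).
  by rewrite mulrBl mulfV// lt0r_neq0.
rewrite normrM normfV (gtr0_norm nL) -mulrA.
have -> : (n%:R * L)^-1 * n%:R = L^-1.
  by rewrite invfM mulrAC mulVf ?mul1r// lt0r_neq0.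
by rewrite ler_pM2r ?invr_gt0// ler_norml; apply/andP; split; lra.
Qed.

End Directions.

Theorem theorem4p1 (R : realType) (G : topologicalGroupType)
    (Gamma : connected_graph) (a : graph_action G Gamma) (delta : R)
    (G_hausdorff : hausdorff_space G)
    (G_totally_disconnected : totally_disconnected [set: G])
    (G_locally_compact : locally_compact [set: G])
    (Gamma_locally_finite : locally_finite Gamma)
    (Gamma_hyperbolic : gromov_hyperbolic (realization R Gamma) delta)
    (a_transitive : vertex_transitive a)
    (a_stabiliser : forall v : Gamma,
       compact (stabiliser a v) /\ open (stabiliser a v)) :
  (exists f : set G -> set (R -> realization R Gamma),
     [/\ set_fun (directions R G) (boundary (realization R Gamma)) f,
         set_inj (directions R G) f &
         forall g : G, moves_to_infinity (inner g) ->
           attracting_point (point_action (R := R) a g) (f (direction R g))]) /\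
  (forall g h : G, moves_to_infinity (inner g) -> moves_to_infinity (inner h) ->
     ~ asymptotic R (inner g) (inner h) ->
     delta_dist (inner g) (inner h) (2 : R)%:E).
Proof.
have [v _] := cgraph_nonempty Gamma.
have [_ four] := Gamma_hyperbolic.
have lf := Gamma_locally_finite; have tra := a_transitive;
  have stab := a_stabiliser.
pose o g := @orb R G Gamma a v g.
(* [f] picks the limit of an arbitrary representative; [uniq] shows that all
   representatives have the same one. *)
pose limit_of (D : set G) om := exists g r, [/\ moves_to_infinity (inner g), direction R g = D,
  geodesic_ray r, equivalent_at_infinity (ray_seq r) (o g) & om = ray_class r].
have attr g : moves_to_infinity (inner g) -> exists2 r, limit_of (direction R g) (ray_class r) &
    attracting_point (point_action (R := R) a g) (ray_class r).
  move=> mg; have [r [rr hr] ar] := orb_attracting lf tra stab four v mg.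
  by exists r => //; exists g, r.
have same_dir g h : moves_to_infinity (inner g) -> moves_to_infinity (inner h) ->
    direction R g = direction R h <-> equivalent_at_infinity (o g) (o h).
  move=> mg mh; split=> [e|gh]; last first.
    by apply: (direction_eq stab v);
      exact: (same_end_asymptotic lf tra stab four mg mh gh).
  apply: (asymptotic_same_end lf tra stab four v mg mh).
  have : direction R h h by exact: (asymptotic_refl R stab v).
  by rewrite -e.
have uniq D om om' : limit_of D om -> limit_of D om' -> om = om'.
  move=> [g [r [mg gD rr hr ->]]] [h [r' [mh hD rr' hr' ->]]].
  apply/(ray_class_eq four rr rr'); apply: (eqv_trans four hr).
  by apply: (eqv_trans four _ (eqv_sym hr')); apply/same_dir => //;
    rewrite gD hD.
pose f D := xget set0 [set om | limit_of D om].
have fP D : directions R G D -> limit_of D (f D).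
  move=> [g mg <-]; have [r lr _] := attr g mg.
  by rewrite /f; case: xgetP => [om _ //|/(_ (ray_class r))].
split.
  exists f; split.
  - by move=> D /fP[g [r [_ _ rr _ ->]]]; exists r.
  - move=> D D'; rewrite !inE => /fP fD /fP fD' e.
    have [g [r [mg gD rr hr e1]]] := fD;
      have [h [r' [mh hD rr' hr' e2]]] := fD'.
    rewrite -gD -hD; apply/same_dir => //; apply: (eqv_trans four (eqv_sym hr)).
    apply: (eqv_trans four _ hr'); apply/(ray_class_eq four rr rr').
    by rewrite -e1 -e2.
  - move=> g mg; have [r lr ar] := attr g mg.
    by rewrite (uniq _ _ _ (fP (direction R g) _) lr)//; exists g.
move=> g h mg mh nas.
have ngh : ~ equivalent_at_infinity (o g) (o h).
  by move=> gh; apply: nas; exact: (same_end_asymptotic lf tra stab four mg mh gh).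
exists 1%:E, 1%:E; split; last by rewrite -EFinD.
  exact: (delta_plus1 lf tra stab four mg mh ngh).
by apply: (delta_plus1 lf tra stab four (v := v) mh mg) => hg; apply: ngh;
  exact: (eqv_sym hg).
Qed.
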